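(* Let $s$ be a symplectic form on a vector space $V$ of finite dimension $n>0$ over an infinite field $\mathbb{F}$ of characteristic not $2$. (a) If $n$ is a multiple of $4$, then every element of $\mathrm{Sp}(s)$ is the product of four involutions of $\mathrm{Sp}(s)$, and there exists an element of $\mathrm{Sp}(s)$ that is not the product of three involutions of $\mathrm{Sp}(s)$. (b) If $n\equiv 2 \pmod 4$ and $n>2$, then every element of $\mathrm{Sp}(s)$ is the product of five involutions of $\mathrm{Sp}(s)$, and there exists an element of $\mathrm{Sp}(s)$ that is not the product of three involutions of $\mathrm{Sp}(s)$.
   Context: A symplectic form on a finite-dimensional vector space $V$ is a nondegenerate alternating bilinear form $s:V\times V\to\mathbb{F}$; $\mathrm{Sp}(s)$ is the group of all $u\in\mathrm{GL}(V)$ with $s(u(x),u(y))=s(x,y)$ for all $x,y\in V$. An involution of a group is an element of order $1$ or $2$, i.e. an element $i$ with $i^2$ equal to the identity (the identity is allowed). *)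

(* Defs.v *)
From HB Require Import structures.
From mathcomp Require Import all_boot all_order all_algebra.
From mathcomp Require Import classical_sets cardinality.

Set Implicit Arguments.
Unset Strict Implicit.
Unset Printing Implicit Defensive.

Import GRing.Theory.
Local Open Scope ring_scope.

Section Symplectic.
Variables (F : fieldType) (V : vectType F) (s : {biscalar V}).

Definition alternating : Prop := forall x : V, s x x = 0.

(* An alternating form is skew-symmetric, so its left and right radicals
   coincide and it is enough to consider one of them. *)
Definition nondegenerate_form : Prop :=
  forall x : V, (forall y : V, s x y = 0) -> x = 0.

Definition symplectic_form : Prop := alternating /\ nondegenerate_form.

Definition Sp (u : 'End(V)) : Prop :=
  bijective u /\ forall x y : V, s (u x) (u y) = s x y.

(* The identity is allowed. *)
Definition Sp_involution (i : 'End(V)) : Prop :=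
  Sp i /\ (i \o i)%VF = \1%VF.

Definition prod_of_Sp_involutions (k : nat) (u : 'End(V)) : Prop :=
  exists i : 'I_k -> 'End(V),
    (forall j : 'I_k, Sp_involution (i j)) /\
    u = \big[@comp_lfun F V V V / \1%VF]_(j < k) i j.

End Symplectic.

(* Main.v *)
Require Import Defs.
From HB Require Import structures.
From mathcomp Require Import all_boot all_order all_algebra.
From mathcomp Require Import classical_sets cardinality.
From mathcomp Require Import boolp fingroup perm ring zify.

(* A transvection [t] is at rank distance 1 from the identity.  In [Sp] the rank
   of [i j - c] is even for involutions [i], [j], because [(i j - c) S] is, up to
   an invertible factor, the skew-symmetric matrix [(j - c i) S].  If [t] were
   [i j k], then [i j] and [k] would have even ranks differing by at most 1 after
   any scalar shift; hence [i j] would be an involution too, and [t = (i j) k]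
   would contradict the parity of the rank of [t - 1].

   For the upper bound, suppose that [u] has a Lagrangian [L] on which
   [s (u x) y] is symmetric and nondegenerate.  For every [a] that is
   self-adjoint for this form, [L] can be completed to a symplectic basis in
   which [u] is a lower unitriangular matrix times [diag(a, a^-T)] times an upper
   one.  If [dim L] is even and [a] is a scalar [x = y z], both
   [lower * diag(y, 1/y)] and [diag(z, 1/z) * upper] are conjugate to a diagonal
   matrix reversed by an involution, so [u] is a product of four involutions.

   In general, put [v = u + u^-1] and [Y = u - u^-1], so that [v] is self-adjoint
   for [s] and [Y] is skew.  The space is an orthogonal sum of spaces carrying
   such a Lagrangian [F[v] x] and of spaces on which [u] is unipotent up to a sign
   [e].  On the latter [u] is reversed by an involution, but they also carry an
   odd-dimensional Lagrangian [M] such that [(u - e) M] lies in a complementary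
   Lagrangian.  Adding [M] to [L], with [a = e], restores an even dimension, unless
   the whole space is of the first kind with [dim L] odd, which forces
   [n = 2 mod 4].  In that case one takes for [a] a transposition times
   [diag(1, x, .., x)] such that the upper factor has a zero corner, and one extra
   involution clears the corner of the lower factor. *)

Set Implicit Arguments.
Unset Strict Implicit.
Unset Printing Implicit Defensive.

Import GRing.Theory.
Local Open Scope ring_scope.

(** * Isometries, involutions and reversible elements of a form given by its matrix *)

Section MatrixGroup.
Variables (F : fieldType) (n : nat).
Implicit Types S u i k M : 'M[F]_n.

(** Row vectors are used: [u] acts on the right and preserves [x *m S *m y^T]. *)
Definition mx_isom S u : Prop := u *m S *m u^T = S.

Definition mx_invol S i : Prop := mx_isom S i /\ i *m i = 1%:M.

(* Equivalently, [M] is a product of two involutions: [M = i (i M)]. *)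
Definition mx_reversible S M : Prop :=
  mx_isom S M /\ exists2 i, mx_invol S i & i *m M *m i *m M = 1%:M.

Definition mx_prod4 S u : Prop :=
  exists M1 M2, [/\ mx_reversible S M1, mx_reversible S M2 & u = M1 *m M2].

Definition mx_prod5 S u : Prop :=
  exists k v, [/\ mx_invol S k, mx_prod4 S v & u = k *m v].

Lemma mx_isom1 S : mx_isom S 1%:M.
Proof. by rewrite /mx_isom mul1mx trmx1 mulmx1. Qed.

Lemma mx_isomM S u v : mx_isom S u -> mx_isom S v -> mx_isom S (u *m v).
Proof.
move=> hu hv; rewrite /mx_isom trmx_mul.
by rewrite -[RHS]hu -[S in RHS]hv !mulmxA.
Qed.

Lemma mx_isom_unit S u : S \in unitmx -> mx_isom S u -> u \in unitmx.
Proof.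
by move=> hS hu; have := hS; rewrite -{1}hu !unitmx_mul => /andP[/andP[]].
Qed.

Lemma mx_isomV S u : S \in unitmx -> mx_isom S u -> mx_isom S (invmx u).
Proof.
move=> hS hu; have uu := mx_isom_unit hS hu.
by rewrite /mx_isom -{1}hu !mulmxA mulVmx // mul1mx -mulmxA -trmx_mul mulVmx // trmx1 mulmx1.
Qed.

Lemma mx_isom_tr S u : S \in unitmx -> mx_isom S u -> S *m u^T = invmx u *m S.
Proof.
move=> hS hu; have uu := mx_isom_unit hS hu.
by rewrite -{2}hu !mulmxA mulVmx // mul1mx.
Qed.

Lemma mx_invol1 S : mx_invol S 1%:M.
Proof. by split; [apply: mx_isom1 | rewrite mulmx1]. Qed.

Lemma mx_reversible1 S : mx_reversible S 1%:M.
Proof.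
by split; [apply: mx_isom1 | exists 1%:M; rewrite ?mulmx1 //; apply: mx_invol1].
Qed.

Lemma mx_reversible_prod4 S M : mx_reversible S M -> mx_prod4 S M.
Proof.
by move=> hM; exists M, 1%:M; split; rewrite ?mulmx1 //; apply: mx_reversible1.
Qed.

Lemma mx_reversible_invols S M : mx_reversible S M ->
  exists i j, [/\ mx_invol S i, mx_invol S j & M = i *m j].
Proof.
move=> [hM [i hi e]]; exists i, (i *m M); split=> //; last first.
  by case: hi => _ hi; rewrite mulmxA hi mul1mx.
split; first by apply: mx_isomM => //; case: hi.
by rewrite !mulmxA.
Qed.

End MatrixGroup.

(** * Change of basis *)

Section BasisChange.
Variables (F : fieldType) (n : nat).
Implicit Types S u i k M P : 'M[F]_n.

Lemma mx_isom_congr S P u : P \in unitmx ->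
  mx_isom (P *m S *m P^T) (P *m u *m invmx P) <-> mx_isom S u.
Proof.
move=> hP; rewrite /mx_isom !trmx_mul.
have hPT : P^T \in unitmx by rewrite unitmx_tr.
have -> : P *m u *m invmx P *m (P *m S *m P^T) *m ((invmx P)^T *m (u^T *m P^T))
   = P *m (u *m S *m u^T) *m P^T.
  rewrite !mulmxA mulmxKV // -(mulmxA _ P^T) trmx_inv mulmxV // mulmx1 -!mulmxA //.
split=> [e | -> //].
by move: e => /(can_inj (mulmxK hPT)) /(can_inj (mulKmx hP)).
Qed.

Lemma mx_invol_congr S P i : P \in unitmx ->
  mx_invol (P *m S *m P^T) (P *m i *m invmx P) <-> mx_invol S i.
Proof.
move=> hP; rewrite /mx_invol mx_isom_congr //.
have -> : P *m i *m invmx P *m (P *m i *m invmx P) = P *m (i *m i) *m invmx P.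
  by rewrite !mulmxA mulmxKV.
split=> -[hi e]; split=> //; last by rewrite e mulmx1 mulmxV.
apply: (can_inj (mulKmx hP)); apply: (can_inj (mulmxK (_ : invmx P \in unitmx))).
  by rewrite unitmx_inv.
by rewrite e mulmx1 mulmxV.
Qed.

Lemma mx_reversible_congr S P M : P \in unitmx ->
  mx_reversible (P *m S *m P^T) (P *m M *m invmx P) <-> mx_reversible S M.
Proof.
move=> hP; have hP' : invmx P \in unitmx by rewrite unitmx_inv.
have conjP A : P *m (invmx P *m A *m P) *m invmx P = A.
  by rewrite !mulmxA mulmxV // mul1mx mulmxK.
have key i : P *m i *m invmx P *m (P *m M *m invmx P) *m (P *m i *m invmx P)
      *m (P *m M *m invmx P) = P *m (i *m M *m i *m M) *m invmx P.
  by rewrite !mulmxA !mulmxKV.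
split=> -[hM [i hi e]]; split; [exact/(mx_isom_congr _ _ hP) | | exact/mx_isom_congr |].
  exists (invmx P *m i *m P).
    by apply/(mx_invol_congr S (invmx P *m i *m P) hP); rewrite conjP.
  apply: (can_inj (mulKmx hP)); apply: (can_inj (mulmxK hP')).
  by rewrite -key conjP e mulmx1 mulmxV.
exists (P *m i *m invmx P); first exact/mx_invol_congr.
by rewrite key e mulmx1 mulmxV.
Qed.

Lemma mx_reversible_conj S P M : S \in unitmx -> mx_isom S P ->
  mx_reversible S M -> mx_reversible S (P *m M *m invmx P).
Proof.
move=> hS hP hM; have uP := mx_isom_unit hS hP.
by rewrite -{1}hP; apply/mx_reversible_congr.
Qed.

Lemma mx_prod4_congr S P u : P \in unitmx ->
  mx_prod4 (P *m S *m P^T) (P *m u *m invmx P) -> mx_prod4 S u.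
Proof.
move=> hP [M1 [M2 [h1 h2 e]]].
have conjP A : A = P *m (invmx P *m A *m P) *m invmx P.
  by rewrite !mulmxA mulmxV // mul1mx mulmxK.
exists (invmx P *m M1 *m P), (invmx P *m M2 *m P); split.
- by apply/(mx_reversible_congr S (invmx P *m M1 *m P) hP); rewrite -(conjP M1).
- by apply/(mx_reversible_congr S (invmx P *m M2 *m P) hP); rewrite -(conjP M2).
- rewrite !mulmxA mulmxK // -(mulmxA (invmx P)) -e !mulmxA mulVmx // mul1mx.
  by rewrite mulmxKV.
Qed.

Lemma mx_prod5_congr S P u : P \in unitmx ->
  mx_prod5 (P *m S *m P^T) (P *m u *m invmx P) -> mx_prod5 S u.
Proof.
move=> hP [k [v [h1 h2 e]]].
have conjP A : A = P *m (invmx P *m A *m P) *m invmx P.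
  by rewrite !mulmxA mulmxV // mul1mx mulmxK.
exists (invmx P *m k *m P), (invmx P *m v *m P); split.
- by apply/(mx_invol_congr S (invmx P *m k *m P) hP); rewrite -(conjP k).
- by apply: (mx_prod4_congr hP); rewrite -(conjP v).
- rewrite !mulmxA mulmxK // -(mulmxA (invmx P)) -e !mulmxA mulVmx // mul1mx.
  by rewrite mulmxKV.
Qed.

End BasisChange.

(** * Orthogonal sums *)

Section BlockSum.
Variables (F : fieldType) (n1 n2 : nat).
Variables (S1 : 'M[F]_n1) (S2 : 'M[F]_n2).
Let S := block_mx S1 0 0 S2.

Lemma mul_block_diag (A C : 'M[F]_n1) (B D : 'M[F]_n2) :
  block_mx A 0 0 B *m block_mx C 0 0 D = block_mx (A *m C) 0 0 (B *m D).
Proof. by rewrite mulmx_block !mulmx0 !mul0mx !addr0 !add0r. Qed.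

Lemma mx_isom_block u1 u2 :
  mx_isom S1 u1 -> mx_isom S2 u2 -> mx_isom S (block_mx u1 0 0 u2).
Proof.
move=> h1 h2; rewrite /mx_isom /S tr_block_mx !trmx0 !mul_block_diag.
by rewrite [in LHS]h1 h2.
Qed.

Lemma mx_invol_block i1 i2 :
  mx_invol S1 i1 -> mx_invol S2 i2 -> mx_invol S (block_mx i1 0 0 i2).
Proof.
move=> [h1 e1] [h2 e2]; split; first exact: mx_isom_block.
by rewrite mul_block_diag e1 e2 -scalar_mx_block.
Qed.

Lemma mx_reversible_block M1 M2 :
  mx_reversible S1 M1 -> mx_reversible S2 M2 -> mx_reversible S (block_mx M1 0 0 M2).
Proof.
move=> [h1 [i1 k1 e1]] [h2 [i2 k2 e2]]; split; first exact: mx_isom_block.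
exists (block_mx i1 0 0 i2); first exact: mx_invol_block.
by rewrite !mul_block_diag e1 e2 -scalar_mx_block.
Qed.

Lemma mx_prod4_block u1 u2 :
  mx_prod4 S1 u1 -> mx_prod4 S2 u2 -> mx_prod4 S (block_mx u1 0 0 u2).
Proof.
move=> [A [B [hA hB ->]]] [C [D [hC hD ->]]].
exists (block_mx A 0 0 C), (block_mx B 0 0 D).
by split; [exact: mx_reversible_block | exact: mx_reversible_block
          | rewrite mul_block_diag].
Qed.

End BlockSum.

(** * Transvections *)

Section Transvection.
Variables (F : fieldType) (n : nat) (S : 'M[F]_n).
Hypothesis two_neq0 : 2%:R != 0 :> F.
Hypotheses (S_skew : S^T = - S) (S_unit : S \in unitmx).

(** Writing [A = B^T *m N *m B] with the rows of [B] a basis of the row space makes [N] skew and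
    invertible of size [r = \rank A]. Then [\det N = (-1) ^+ r * \det N], which excludes odd [r]
    since 2 is nonzero. *)
Lemma skew_rank_even (A : 'M[F]_n) : A^T = - A -> ~~ odd (\rank A).
Proof.
move=> hA.
have [r [B [N [freeB defA rA]]]] : exists r (B : 'M[F]_(r, n)) (N : 'M[F]_r),
    [/\ row_free B, A = B^T *m N *m B & \rank A = r].
  exists (\rank A), (row_base A); set B := row_base A.
  have freeB : row_free B by apply: row_base_free.
  have /submxP[X eX] : (A <= B)%MS by rewrite eq_row_base.
  have /submxP[Z eZ] : (X^T <= B)%MS.
    have [B' eB'] := row_freeP freeB.
    have := congr1 (mulmx^~ B') eX; rewrite /= -mulmxA eB' mulmx1 => <-.
    by rewrite trmx_mul hA mulmxN eqmx_opp /B eq_row_base submxMl.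
  by exists Z^T; split; rewrite // -trmx_mul -eZ trmxK.
have [B' eB'] := row_freeP freeB.
have eB'T : B'^T *m B^T = 1%:M by rewrite -trmx_mul eB' trmx1.
have defN : N = B'^T *m A *m B'.
  by rewrite defA !mulmxA eB'T mul1mx -mulmxA eB' mulmx1.
have hN : N^T = - N.
  by rewrite defN !trmx_mul trmxK hA mulNmx mulmxN mulmxA.
have uN : N \in unitmx.
  rewrite -row_full_unit /row_full eqn_leq rank_leq_row /=.
  by rewrite -{1}rA {1}defA -mulmxA; apply: leq_trans (mxrankM_maxr _ _) (mxrankM_maxl _ _).
rewrite rA; apply/negP=> odd_r; have := det_tr N; rewrite hN -scaleN1r detZ -signr_odd odd_r.
rewrite expr1 mulN1r => /eqP; rewrite eq_sym -subr_eq0 opprK -mulr2n -mulr_natl.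
by rewrite mulf_eq0 (negPf two_neq0) /=; apply/negP; rewrite -unitfE -unitmxE.
Qed.

Lemma two_invol_rank_even i j c : mx_invol S i -> mx_invol S j ->
  ~~ odd (\rank (i *m j - c%:M)).
Proof.
(* Multiplying [k *m S *m k^T = S] by [k] on the left gives [S *m k^T = k *m S]. *)
have skewS k : mx_invol S k -> (k *m S)^T = - (k *m S).
  move=> [hk kk]; rewrite trmx_mul S_skew mulNmx; apply: congr1.
  by rewrite -[in RHS]hk !mulmxA kk mul1mx.
move=> hi hj; have [_ ii] := hi.
have ui : i \in unitmx by case: (mulmx1_unit ii).
have -> : \rank (i *m j - c%:M) = \rank ((j - c *: i) *m S).
  have -> : i *m j - c%:M = i *m (j - c *: i).
    by rewrite mulmxBr -scalemxAr ii scalemx1.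
  by rewrite [RHS]mxrankMfree ?row_free_unit // eqmxMfull // row_full_unit.
apply: skew_rank_even; rewrite mulmxBl linearB /= -scalemxAl linearZ /=.
by rewrite (skewS i) // (skewS j) // scalerN opprB opprK addrC.
Qed.

Variable w : 'rV[F]_n.
Hypothesis w_neq0 : w != 0.

(** On row vectors this is the map [x |-> x + s(x, w) w]. *)
Definition transvection : 'M[F]_n := 1%:M + S *m w^T *m w.

Lemma form_diag0 (x : 'rV[F]_n) : x *m S *m x^T = 0.
Proof.
apply/matrixP=> a b; rewrite !ord1 [RHS]mxE; set y := x *m S *m x^T.
have e : y^T = - y by rewrite /y !trmx_mul trmxK S_skew mulNmx mulmxN mulmxA.
have := congr1 (fun z : 'M_1 => z 0 0) e; rewrite !mxE => /eqP.
rewrite -subr_eq0 opprK -mulr2n -mulr_natl mulf_eq0 (negPf two_neq0) /=.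
by move/eqP.
Qed.

Lemma transvection_isom : mx_isom S transvection.
Proof.
rewrite /mx_isom /transvection linearD /= trmx1 !trmx_mul trmxK S_skew.
rewrite mulmxDl mul1mx mulmxDr mulmx1 mulmxDl.
have -> : S *m w^T *m w *m S *m (w^T *m (w *m - S)) = 0.
  by rewrite !mulmxA -(mulmxA _ _ S) -(mulmxA _ (w *m S)) form_diag0 mulmx0 !mul0mx.
by rewrite addr0 !mulmxN !mulmxA -addrA subrr addr0.
Qed.

Lemma transvection_rank : \rank (transvection - 1%:M) = 1%N.
Proof.
rewrite /transvection addrC addKr -mulmxA eqmxMfull ?row_full_unit //.
apply/eqP; rewrite eqn_leq (leq_trans (mxrankM_maxl _ _)) ?rank_leq_col //=.
rewrite lt0n mxrank_eq0; apply: contra w_neq0 => /eqP e.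
have [k hk] : exists k, w 0 k != 0.
  apply/existsP; apply: contraR w_neq0; rewrite negb_exists => /forallP h.
  by apply/eqP/rowP=> k; rewrite mxE; apply/eqP; move: (h k); rewrite negbK.
apply/eqP/rowP=> l; rewrite mxE; apply/eqP; have /matrixP/(_ k l) := e.
rewrite !mxE big_ord1 !mxE => /eqP; rewrite mulf_eq0 (negPf hk) //.
Qed.

Lemma transvection_not_prod3 i j k : mx_invol S i -> mx_invol S j ->
  mx_invol S k -> transvection <> i *m j *m k.
Proof.
move=> hi hj hk et; have [hk1 kk] := hk.
pose g := i *m j; have etg : transvection *m k = g by rewrite et -mulmxA kk mulmx1.
have uk : k \in unitmx by case: (mulmx1_unit kk).
have rk1 c : ~~ odd (\rank (k - c%:M)).
  by rewrite -[k]mulmx1; apply: two_invol_rank_even => //; apply: mx_invol1.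
have diff1 : \rank (g - k) = 1%N.
  rewrite -etg -{2}[k]mul1mx -mulmxBl mxrankMfree ?row_free_unit //.
  exact: transvection_rank.
have even_close a b : ~~ odd a -> ~~ odd b -> (a <= 1 + b)%N -> (b <= 1 + a)%N -> a = b.
  by lia.
have same c : \rank (g - c%:M) = \rank (k - c%:M).
  apply: even_close => //; first exact: two_invol_rank_even.
    have -> : g - c%:M = (g - k) + (k - c%:M) by rewrite addrA subrK.
    by rewrite -diff1; apply: mxrank_add.
  have -> : k - c%:M = (k - g) + (g - c%:M) by rewrite addrA subrK.
  by rewrite -diff1 -(mxrank_opp (g - k)) opprB; apply: mxrank_add.
have two_unit : 2%:R *: (1%:M : 'M[F]_n) \in unitmx.
  by rewrite scalemx1 unitmxE det_scalar unitrX ?unitfE.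
(* As 1 and -1 differ, the two eigenspaces meet trivially, so [h] squares to 1 exactly when their
   dimensions add up to at least [n]. This condition only sees ranks, hence passes from [k] to
   [g]. *)
have rank_pm (h : 'M[F]_n) : (h - 1%:M) *m (h - (-1)%:M) = 0 <->
    (\rank (h - 1%:M)%R + \rank (h - (-1)%:M)%R <= n)%N.
  have cap0 : (kermx (h - 1%:M) :&: kermx (h - (-1)%:M) <= (0 : 'M[F]_n))%MS.
    rewrite submx0; apply/eqP; set K := (_ :&: _)%MS.
    have /sub_kermxP e1 : (K <= kermx (h - 1%:M))%MS by apply: capmxSl.
    have /sub_kermxP e2 : (K <= kermx (h - (-1)%:M))%MS by apply: capmxSr.
    apply: (can_inj (mulmxK two_unit)); rewrite mul0mx -[RHS](subrr 0).
    rewrite -{1}e2 -e1 -mulmxBr; congr (_ *m _).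
    by rewrite opprB addrC addrA subrK raddfN /= opprK -raddfD scalemx1 -mulr2n.
  split=> [e | le_n].
    rewrite addnC -(leq_subRL) ?rank_leq_row // -mxrank_ker.
    by apply: mxrankS; apply/sub_kermxP.
  have rsum : (n <= \rank (kermx (h - 1%:M) + kermx (h - (-1)%:M)))%N.
    have := mxrank_sum_cap (kermx (h - 1%:M)) (kermx (h - (-1)%:M)).
    move: cap0; rewrite submx0 -mxrank_eq0 => /eqP->; rewrite !mxrank_ker.
    have := rank_leq_row (h - 1%:M); have := rank_leq_row (h - (-1)%:M); lia.
  have full : row_full (kermx (h - 1%:M) + kermx (h - (-1)%:M))%MS.
    by rewrite /row_full eqn_leq rank_leq_col.
  have comm_h : (h - 1%:M) *m (h - (-1)%:M) = (h - (-1)%:M) *m (h - 1%:M).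
    by rewrite !mulmxBl !mulmxBr !mul1mx !mulmx1 scalar_mxC opprB addrACA [- _ + _]addrC !opprB;
      rewrite -!addrA; congr (_ + _); rewrite addrCA addrC -!addrA; congr (_ + _); rewrite addrC.
  apply/eqP; rewrite -submx0 -[X in (X <= _)%MS]mul1mx.
  apply: submx_trans (submxMr _ (submx_full 1%:M full)) _.
  rewrite addsmxMr addsmx_sub !submx0 mulmxA.
  have /sub_kermxP-> := submx_refl (kermx (h - 1%:M)); rewrite mul0mx eqxx /=.
  rewrite comm_h mulmxA; have /sub_kermxP-> := submx_refl (kermx (h - (-1)%:M)).
  by rewrite mul0mx.
have sqE (h : 'M[F]_n) : (h - 1%:M) *m (h - (-1)%:M) = h *m h - 1%:M.
  rewrite raddfN /= opprK mulmxBl mulmxDr mulmx1 mul1mx opprD addrA addrK //.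
have gg : g *m g = 1%:M.
  apply/eqP; rewrite -subr_eq0 -sqE; apply/eqP/rank_pm; rewrite !same.
  by apply/rank_pm; rewrite sqE kk subrr.
have hg : mx_invol S g.
  by split=> //; apply: mx_isomM; [case: hi | case: hj].
have := two_invol_rank_even 1 hg hk; rewrite -et.
by rewrite transvection_rank.
Qed.

End Transvection.

Lemma infinite_avoid (T : choiceType) (s : seq T) :
  infinite_set [set: T]%classic -> exists x, x \notin s.
Proof.
move=> infT; apply: contrapT => h; apply: infT.
apply: (@sub_finite_set _ _ [set` s]%classic) => [x _ /=|]; last exact: finite_seq.
by apply: contrapT => /negP hx; apply: h; exists x.
Qed.

(** * Block triangular factorisation *)

Section StandardForm.
Variables (F : fieldType) (m : nat).
Implicit Types a g K D Z : 'M[F]_m.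

(** The Gram matrix of a symplectic basis cut into two Lagrangian halves. [lower_mx] and [upper_mx]
    fix pointwise the first and the second half respectively, and [levi_mx] stabilises both. *)
Definition std_form : 'M[F]_(m + m) := block_mx 0 1%:M (- 1%:M) 0.
Definition lower_mx K : 'M[F]_(m + m) := block_mx 1%:M 0 K 1%:M.
Definition upper_mx D : 'M[F]_(m + m) := block_mx 1%:M D 0 1%:M.
Definition levi_mx g : 'M[F]_(m + m) := block_mx g 0 0 (invmx g)^T.

Let bmxE := (mulmx0, mul0mx, mulmx1, mul1mx, addr0, add0r, mulNmx, mulmxN, oppr0).

Lemma std_form_unit : std_form \in unitmx.
Proof.
have /mulmx1_unit[] // : std_form *m (- std_form) = 1%:M.
by rewrite mulmxN mulmx_block !bmxE opp_block_mx oppr0 opprK -scalar_mx_block.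
Qed.

Lemma lower_mxD K1 K2 : lower_mx K1 *m lower_mx K2 = lower_mx (K1 + K2).
Proof. by rewrite mulmx_block !bmxE. Qed.

Lemma lower_mx0 : lower_mx 0 = 1%:M.
Proof. by rewrite /lower_mx -scalar_mx_block. Qed.

Lemma lower_mx_unit K : lower_mx K \in unitmx.
Proof.
by have /mulmx1_unit[] // : lower_mx K *m lower_mx (- K) = 1%:M
  by rewrite lower_mxD subrr lower_mx0.
Qed.

Lemma invmx_lower K : invmx (lower_mx K) = lower_mx (- K).
Proof.
apply: (can_inj (mulKmx (lower_mx_unit K))).
by rewrite mulmxV ?lower_mx_unit // lower_mxD subrr lower_mx0.
Qed.

Lemma levi_mxM g1 g2 : g1 \in unitmx -> g2 \in unitmx ->
  levi_mx g1 *m levi_mx g2 = levi_mx (g1 *m g2).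
Proof.
move=> u1 u2; rewrite mulmx_block !bmxE /levi_mx; congr block_mx.
have -> : invmx (g1 *m g2) = invmx g2 *m invmx g1.
  have u12 : g1 *m g2 \in unitmx by rewrite unitmx_mul u1.
  apply: (can_inj (mulKmx u12)); rewrite mulmxV // !mulmxA mulmxK // mulmxV //.
by rewrite trmx_mul.
Qed.

Lemma levi_mx_unit g : g \in unitmx -> levi_mx g \in unitmx.
Proof.
move=> ug; have ug' : invmx g \in unitmx by rewrite unitmx_inv.
have /mulmx1_unit[] // : levi_mx g *m levi_mx (invmx g) = 1%:M.
by rewrite levi_mxM // mulmxV // /levi_mx invmx1 trmx1 -scalar_mx_block.
Qed.

Lemma lower_mx_isom K : K^T = K -> mx_isom std_form (lower_mx K).
Proof.
move=> hK; rewrite /mx_isom tr_block_mx !trmx1 trmx0 hK !mulmx_block !bmxE.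
by rewrite addrC addrN.
Qed.

Lemma upper_mx_isom D : D^T = D -> mx_isom std_form (upper_mx D).
Proof.
move=> hD; rewrite /mx_isom tr_block_mx !trmx1 trmx0 hD !mulmx_block !bmxE.
by rewrite addrC addrN.
Qed.

Lemma levi_mx_isom g : g \in unitmx -> mx_isom std_form (levi_mx g).
Proof.
move=> ug; rewrite /mx_isom tr_block_mx !trmx0 trmxK !mulmx_block !bmxE.
by rewrite mulmxV // -trmx_mul mulmxV // trmx1.
Qed.

Lemma levi_lower g K : g \in unitmx ->
  levi_mx g *m lower_mx K = lower_mx ((invmx g)^T *m K *m invmx g) *m levi_mx g.
Proof. by move=> ug; rewrite !mulmx_block !bmxE mulmxKV. Qed.

(** Block elimination. The blocks of the isometry equation give the symmetry of [invmx a *m b] and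
    the value of [d]; then [K] is symmetric because [lower_mx K] is a quotient of isometries. *)
Lemma std_isom_LU a b c d : a \in unitmx ->
  mx_isom std_form (block_mx a b c d) ->
  exists K, [/\ K^T = K, (invmx a *m b)^T = invmx a *m b &
    block_mx a b c d = lower_mx K *m levi_mx a *m upper_mx (invmx a *m b)].
Proof.
move=> ua; rewrite /mx_isom tr_block_mx !mulmx_block !bmxE.
move=> /eq_block_mx[e1 e2 e3 e4].
have ua' : invmx a \in unitmx by rewrite unitmx_inv.
have uT : a^T \in unitmx by rewrite unitmx_tr.
have hD : (invmx a *m b)^T = invmx a *m b.
  apply: (can_inj (mulKmx ua)); apply: (can_inj (mulmxK uT)).
  rewrite mulKVmx // trmx_mul -!mulmxA -trmx_mul mulmxV // trmx1 mulmx1.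
  by apply/eqP; rewrite -subr_eq0 addrC e1.
set D := invmx a *m b in hD *.
have eu : block_mx a b c d = lower_mx (c *m invmx a) *m levi_mx a *m upper_mx D.
  rewrite !mulmx_block !bmxE mulmxKV // mulKVmx //; congr block_mx.
  apply: (can_inj (mulmxK uT)); rewrite mulmxDl -trmx_mul mulmxV // trmx1 -mulmxA -hD.
  rewrite trmx_mul -!mulmxA -trmx_mul mulmxV // trmx1 mulmx1.
  by move/eqP: e3; rewrite -subr_eq0 opprK -addrA addrC addr_eq0 opprK addrC => /eqP.
exists (c *m invmx a); split=> //.
set K := c *m invmx a.
have hu : mx_isom std_form (block_mx a b c d).
  by rewrite /mx_isom tr_block_mx !mulmx_block !bmxE e1 e2 e3 e4.
have hG : mx_isom std_form (levi_mx a *m upper_mx D).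
  by apply: mx_isomM; [apply: levi_mx_isom | apply: upper_mx_isom].
have uG := mx_isom_unit std_form_unit hG.
have : mx_isom std_form (lower_mx K).
  have -> : lower_mx K = block_mx a b c d *m invmx (levi_mx a *m upper_mx D).
    by rewrite eu -(mulmxA (lower_mx K)) mulmxK.
  by apply: mx_isomM => //; apply: mx_isomV => //; apply: std_form_unit.
rewrite /mx_isom tr_block_mx !trmx1 trmx0 !mulmx_block !bmxE => /eq_block_mx[_ _ _].
by move/eqP; rewrite addrC subr_eq0 => /eqP.
Qed.

Section Reversal.
Variables (A B P : 'M[F]_m).
Hypotheses (sumAB : A + B = 1%:M) (AA : A *m A = A) (AT : A^T = A).
Hypotheses (PT : P^T = - P) (AP : A *m P = 0) (PA : P *m A = 0) (PP : P *m P = - B).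

(** Acts as 1 on the image of the projection [A] and as [x] on that of [B]. The matrix [P] is skew
    and invertible on the image of [B], whose dimension is therefore even in characteristic not
    2. *)
Definition two_level x : 'M[F]_m := A + x *: B.

Let BE : B = 1%:M - A. Proof. by rewrite -sumAB addrC addKr. Qed.
Let AB : A *m B = 0. Proof. by rewrite BE mulmxBr mulmx1 AA subrr. Qed.
Let BA : B *m A = 0. Proof. by rewrite BE mulmxBl mul1mx AA subrr. Qed.
Let BB : B *m B = B. Proof. by rewrite {2}BE mulmxBr mulmx1 BA subr0. Qed.
Let BT : B^T = B. Proof. by rewrite BE linearB /= trmx1 AT. Qed.

Lemma two_levelM x y : two_level x *m two_level y = two_level (x * y).
Proof.
rewrite /two_level mulmxDl !mulmxDr -!scalemxAl -!scalemxAr AA AB BA BB.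
by rewrite !scaler0 addr0 add0r scalerA.
Qed.

Lemma two_level1 : two_level 1 = 1%:M.
Proof. by rewrite /two_level scale1r sumAB. Qed.

Lemma two_level_unit x : x != 0 -> two_level x \in unitmx.
Proof.
move=> x0; have /mulmx1_unit[] // : two_level x *m two_level x^-1 = 1%:M.
by rewrite two_levelM divff // two_level1.
Qed.

Lemma invmx_two_level x : x != 0 -> invmx (two_level x) = two_level x^-1.
Proof.
move=> x0; apply: (can_inj (mulKmx (two_level_unit x0))).
by rewrite mulmxV ?two_level_unit // two_levelM divff // two_level1.
Qed.

Lemma two_level_tr x : (two_level x)^T = two_level x.
Proof. by rewrite /two_level linearD linearZ /= AT BT. Qed.

(** The reversing involution is the identity on the [A] part of both Lagrangians and uses [P] to
    exchange the eigenspaces of [x] and [x^-1] on the [B] part. It is an isometry because [P] is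
    skew. *)
Lemma two_level_reversible x : x != 0 ->
  mx_reversible std_form (levi_mx (two_level x)).
Proof.
move=> x0; have ux := two_level_unit x0; split; first exact: levi_mx_isom.
have PB : P *m B = P by rewrite BE mulmxBr mulmx1 PA subr0.
exists (block_mx A P (- P) A).
  split.
    rewrite /mx_isom tr_block_mx linearN /= PT AT opprK !mulmx_block !bmxE.
    by rewrite AA AP PA PP !oppr0 ?addr0 opprK -opprD ![B + A]addrC sumAB.
  by rewrite mulmx_block !bmxE AA AP PA PP !oppr0 !addr0 opprK [B + A]addrC sumAB -scalar_mx_block.
rewrite /levi_mx invmx_two_level // two_level_tr.
have AG y : A *m two_level y = A by rewrite mulmxDr AA -scalemxAr AB scaler0 addr0.
have PG y : P *m two_level y = y *: P by rewrite mulmxDr PA -scalemxAr PB add0r.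
have -> : block_mx A P (- P) A *m block_mx (two_level x) 0 0 (two_level x^-1) =
    block_mx A (x^-1 *: P) (- (x *: P)) A.
  by rewrite mulmx_block !bmxE !AG !PG.
rewrite -(mulmxA _ (block_mx A P (- P) A)).
have -> : block_mx A P (- P) A *m block_mx (two_level x) 0 0 (two_level x^-1) =
    block_mx A (x^-1 *: P) (- (x *: P)) A.
  by rewrite mulmx_block !bmxE !AG !PG.
rewrite mulmx_block !bmxE -!scalemxAl -!scalemxAr AA AP PA PP !scaler0 !oppr0 !addr0.
by rewrite !scalerA mulVf // mulfV // scale1r opprK [B + A]addrC sumAB
  -scalar_mx_block.
Qed.

(** With [g = two_level x], the map [Z |-> Z g - g^-T Z] multiplies the blocks [AA], [AB], [BA],
    [BB] of [Z] by [0], [x - 1], [1 - x^-1], [x - x^-1]. It can be inverted away from the block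
    [AA], which vanishes in [K]. *)
Lemma lower_two_level_reversible x K : x != 0 -> x ^+ 2 != 1 -> K^T = K ->
  A *m K *m A = 0 -> mx_reversible std_form (lower_mx K *m levi_mx (two_level x)).
Proof.
move=> x0 x2 hK AKA; have ux := two_level_unit x0.
have x1 : x - 1 != 0.
  by rewrite subr_eq0; apply: contra x2 => /eqP->; rewrite expr1n.
have x21 : x ^+ 2 - 1 != 0 by rewrite subr_eq0.
pose c1 := x / (x - 1); pose c2 := x ^+ 2 / (x ^+ 2 - 1).
(* [Z] solves [K g = Z g - g^-T Z] for [g = two_level x], so conjugation by
   [lower_mx Z] turns [levi_mx g] into [lower_mx K *m levi_mx g]. *)
pose Z := c1 *: (A *m K *m B + B *m K *m A) + c2 *: (B *m K *m B).
have hZ : Z^T = Z.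
  rewrite /Z !scalerDr !linearD !linearZ /= !trmx_mul AT BT hK !mulmxA.
  by congr (_ + _); rewrite addrC.
have KE : K = A *m K *m B + B *m K *m A + B *m K *m B.
  rewrite -addrA -mulmxDr sumAB mulmx1 -[A *m K *m B]add0r -AKA -mulmxDr sumAB mulmx1.
  by rewrite -mulmxDl sumAB mul1mx.
have key : K *m two_level x = Z *m two_level x - (invmx (two_level x))^T *m Z.
  rewrite invmx_two_level // two_level_tr {1}KE /Z /two_level.
  set X1 := A *m K *m B; set X2 := B *m K *m A; set X3 := B *m K *m B.
  have rA : (X1 *m A = 0) * (X2 *m A = X2) * (X3 *m A = 0).
    by rewrite /X1 /X2 /X3 -!mulmxA BA AA !mulmx0.
  have rB : (X1 *m B = X1) * (X2 *m B = 0) * (X3 *m B = X3).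
    by rewrite /X1 /X2 /X3 -!mulmxA BB AB !mulmx0.
  have lA : (A *m X1 = X1) * (A *m X2 = 0) * (A *m X3 = 0).
    by rewrite /X1 /X2 /X3 !mulmxA AA AB !mul0mx.
  have lB : (B *m X1 = 0) * (B *m X2 = X2) * (B *m X3 = X3).
    by rewrite /X1 /X2 /X3 !mulmxA BB BA !mul0mx.
  rewrite !(mulmxDr, mulmxDl) -!(scalemxAl, scalemxAr) !(mulmxDr, mulmxDl).
  rewrite !(rA, rB, lA, lB, addr0, add0r, scaler0).
  by apply/matrixP=> i j; rewrite !mxE /c1 /c2; field; rewrite x0 x1 x21.
pose L := lower_mx Z.
have -> : lower_mx K *m levi_mx (two_level x) =
    L *m levi_mx (two_level x) *m invmx L.
  rewrite invmx_lower !mulmx_block !bmxE key addrC //.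
apply: mx_reversible_conj; [exact: std_form_unit | exact: lower_mx_isom |].
exact: two_level_reversible.
Qed.

(** Conjugation by [std_form] exchanges upper and lower matrices and inverts [x]; a conjugation by
    the Levi factor then puts the two factors in the order of the lower case. *)
Lemma upper_two_level_reversible x D : x != 0 -> x ^+ 2 != 1 -> D^T = D ->
  A *m D *m A = 0 -> mx_reversible std_form (levi_mx (two_level x) *m upper_mx D).
Proof.
move=> x0 x2 hD ADA; have ux := two_level_unit x0.
have ux' : two_level x^-1 \in unitmx by apply: two_level_unit; rewrite invr_eq0.
have uG := levi_mx_unit ux'.
have Jinv : invmx std_form = - std_form.
  apply: (can_inj (mulKmx std_form_unit)); rewrite mulmxV ?std_form_unit //.
  by rewrite mulmxN mulmx_block !bmxE opp_block_mx oppr0 opprK -scalar_mx_block.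
have hJ : mx_isom std_form std_form.
  by rewrite /mx_isom tr_block_mx linearN /= !trmx0 trmx1 !mulmx_block !bmxE !opprK.
have -> : levi_mx (two_level x) *m upper_mx D = invmx std_form *m
   (levi_mx (two_level x^-1) *m (lower_mx (- D) *m levi_mx (two_level x^-1)) *m
     invmx (levi_mx (two_level x^-1))) *m invmx (invmx std_form).
  rewrite invmxK mulmxA mulmxK // Jinv.
  rewrite /levi_mx !invmx_two_level ?invr_eq0 // !two_level_tr !invrK.
  by rewrite !mulNmx !mulmx_block !bmxE !opp_block_mx !bmxE !opprK.
apply: mx_reversible_conj; [exact: std_form_unit | | ].
  by apply: mx_isomV => //; exact: std_form_unit.
apply: mx_reversible_conj; [exact: std_form_unit | exact: levi_mx_isom | ].
apply: lower_two_level_reversible; first by rewrite invr_eq0.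
- by rewrite exprVn invr_eq1.
- by rewrite linearN /= hD.
- by rewrite mulmxN mulNmx ADA oppr0.
Qed.

Lemma two_level_prod4 x K D : infinite_set [set: F]%classic -> x != 0 ->
  K^T = K -> D^T = D -> A *m K *m A = 0 -> A *m D *m A = 0 ->
  mx_prod4 std_form (lower_mx K *m levi_mx (two_level x) *m upper_mx D).
Proof.
move=> infF x0 hK hD AKA ADA.
(* The excluded values ensure that neither [y] nor [x / y] is 0, 1 or -1. *)
have [y hy] := infinite_avoid [:: 0; 1; -1; x; - x] infF.
move: hy; rewrite !inE !negb_or => /and5P[y0 y1 yN1 yx yNx].
have z0 : x / y != 0 by rewrite mulf_neq0 ?invr_eq0.
exists (lower_mx K *m levi_mx (two_level y)), (levi_mx (two_level (x / y)) *m upper_mx D).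
split.
- by apply: lower_two_level_reversible; rewrite // sqrf_eq1 negb_or y1.
- apply: upper_two_level_reversible; rewrite // sqrf_eq1 negb_or.
  rewrite -{1}(divff y0) (inj_eq (mulIf _)) ?invr_eq0 // eq_sym yx /=.
  by rewrite -(divff y0) -mulNr (inj_eq (mulIf _)) ?invr_eq0 // -eqr_oppLR eq_sym.
- rewrite !mulmxA -(mulmxA (lower_mx K) (levi_mx (two_level y))) levi_mxM ?two_level_unit // two_levelM.
  by rewrite mulrC divfK.
Qed.

(** The condition on [A *m X *m A] means that [A] has rank at most one, so a single scalar [b] is to
    be cleared. The identity [T *m E *m T = - E] makes [levi_mx T *m lower_mx E] an involution, and
    [A *m T *m A = 0] makes [b] the corner of [E]. *)
Lemma two_level_prod5 x K D T : infinite_set [set: F]%classic -> x != 0 ->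
  K^T = K -> D^T = D -> A *m D *m A = 0 ->
  (forall X, exists b, A *m X *m A = b *: A) ->
  T *m T = 1%:M -> T^T = T -> A *m T *m A = 0 ->
  mx_prod5 std_form (lower_mx K *m levi_mx (T *m two_level x) *m upper_mx D).
Proof.
move=> infF x0 hK hD ADA hA TT hT ATA.
have uT : T \in unitmx by case: (mulmx1_unit TT).
have invT : invmx T = T by apply: (can_inj (mulKmx uT)); rewrite mulmxV.
(* Multiplication by the involution [levi_mx T *m lower_mx E] removes the
   [A]-corner of [T *m K *m T]. *)
have [b hb] := hA (T *m K *m T); pose E := b *: (A - T *m A *m T).
have ET : E^T = E by rewrite /E linearZ /= linearB /= !trmx_mul hT AT mulmxA.
have TET : T *m E *m T = - E.
  rewrite /E -scalemxAr -scalemxAl -scalerN opprB mulmxBr mulmxBl.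
  by rewrite !mulmxA TT mul1mx -!mulmxA TT mulmx1.
have AEA : A *m E *m A = b *: A.
  rewrite /E -scalemxAr -scalemxAl mulmxBr mulmxBl AA AA !mulmxA ATA !mul0mx subr0 //.
exists (levi_mx T *m lower_mx E), (lower_mx (T *m K *m T - E) *m levi_mx (two_level x) *m upper_mx D).
split.
- split; first by apply: mx_isomM; [apply: levi_mx_isom | apply: lower_mx_isom].
  rewrite [X in X *m _]levi_lower // invT hT TET -mulmxA (mulmxA (levi_mx T)).
  by rewrite levi_mxM // TT /levi_mx invmx1 trmx1 -scalar_mx_block mul1mx lower_mxD addNr lower_mx0.
- apply: two_level_prod4 => //; first by rewrite linearB /= !trmx_mul hT hK ET mulmxA.
  by rewrite mulmxBr mulmxBl hb AEA subrr.
- rewrite !mulmxA -(mulmxA (levi_mx T) (lower_mx E)) lower_mxD addrC subrK levi_lower //.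
  rewrite invT hT !mulmxA TT mul1mx -(mulmxA K) TT mulmx1.
  by rewrite -(mulmxA (lower_mx K) (levi_mx T)) levi_mxM ?two_level_unit.
Qed.

End Reversal.
End StandardForm.

(** * Scalar Levi factors in even size and swapped ones in odd size *)

Section OddEven.
Variables (F : fieldType) (h : nat).
Hypothesis infF : infinite_set [set: F]%classic.

Lemma std_form_tr m : (std_form F m)^T = - std_form F m.
Proof. by rewrite tr_block_mx opp_block_mx linearN /= !trmx0 trmx1 oppr0 opprK. Qed.

Lemma std_form_sqr m : std_form F m *m std_form F m = - 1%:M.
Proof.
rewrite mulmx_block !mulmx0 !mul0mx mulmx1 mul1mx !addr0 add0r.
by rewrite [in RHS]scalar_mx_block opp_block_mx !oppr0.
Qed.

(** Here [A = 0] and [B = 1], and the even size provides [P = std_form F h]. *)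
Lemma even_scalar_prod4 x (K D : 'M[F]_(h + h)) : x != 0 -> K^T = K -> D^T = D ->
  mx_prod4 (std_form F _) (lower_mx K *m levi_mx x%:M *m upper_mx D).
Proof.
move=> x0 hK hD; have -> : x%:M = two_level (0 : 'M[F]_(h + h)) 1%:M x.
  by rewrite /two_level add0r scalemx1.
apply: (@two_level_prod4 F _ 0 1%:M (std_form F h)); rewrite ?(mul0mx, mulmx0, trmx0) //.
- by rewrite add0r.
- exact: std_form_tr.
- exact: std_form_sqr.
Qed.

(** In odd size one basis vector is split off, so that the remaining ones are even in number and
    [std_form] can serve as [P]. *)
Definition corner_mx : 'M[F]_(1 + (h + h)) := block_mx 1%:M 0 0 0.
Definition cocorner_mx : 'M[F]_(1 + (h + h)) := block_mx 0 0 0 1%:M.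

Lemma odd_swap_prod5 x (K D T : 'M[F]_(1 + (h + h))) : x != 0 ->
  K^T = K -> D^T = D -> D 0 0 = 0 -> T *m T = 1%:M -> T^T = T -> T 0 0 = 0 ->
  mx_prod5 (std_form F _)
    (lower_mx K *m levi_mx (T *m (corner_mx + x *: cocorner_mx)) *m upper_mx D).
Proof.
move=> x0 hK hD D0 TT hT T0.
have corner X : corner_mx *m X *m corner_mx = X 0 0 *: corner_mx.
  rewrite -[X]submxK /corner_mx !mulmx_block !mulmx0 !mul0mx !mulmx1 !mul1mx !addr0 scale_block_mx !scaler0 submxK.
  congr block_mx; rewrite [ulsubmx X]mx11_scalar scalemx1 !mxE.
  by congr (X _ _)%:M; apply: val_inj.
apply: (@two_level_prod5 F _ corner_mx cocorner_mx (block_mx 0 0 0 (std_form F h))) => //.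
- by rewrite /corner_mx /cocorner_mx add_block_mx !addr0 add0r -scalar_mx_block.
- by rewrite /corner_mx mulmx_block !mulmx0 !mul0mx !mulmx1 !addr0.
- by rewrite /corner_mx tr_block_mx !trmx0 trmx1.
- by rewrite [RHS]opp_block_mx tr_block_mx !trmx0 std_form_tr !oppr0.
- by rewrite /corner_mx mulmx_block !mulmx0 !mul0mx !addr0 block_mx0.
- by rewrite /corner_mx mulmx_block !mulmx0 !mul0mx !addr0 block_mx0.
- by rewrite /cocorner_mx mulmx_block !mulmx0 !mul0mx !addr0 add0r std_form_sqr [RHS]opp_block_mx !oppr0.
- by rewrite corner D0 scale0r.
- by move=> X; exists (X 0 0).
- by rewrite corner T0 scale0r.
Qed.

End OddEven.

Lemma gram_col_mx (F : fieldType) n (S : 'M[F]_n) m1 m2 p1 p2 (A : 'M[F]_(m1, n)) (B : 'M[F]_(m2, n))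
    (C : 'M[F]_(p1, n)) (D : 'M[F]_(p2, n)) :
  col_mx A B *m S *m (col_mx C D)^T =
  block_mx (A *m S *m C^T) (A *m S *m D^T) (B *m S *m C^T) (B *m S *m D^T).
Proof. by rewrite tr_col_mx mul_col_mx mul_col_row. Qed.

(** * Partial diagonalisation of symmetric forms *)

Section SymmetricForm.
Variable F : fieldType.
Hypothesis two_neq0 : 2%:R != 0 :> F.

(** If the diagonal vanishes and [Q i j] does not, adding the basis vector [j] to the vector [i]
    creates the diagonal entry [2 Q i j]. *)
Lemma sym_diag_neq0 k (Q : 'M[F]_k.+1) : Q^T = Q -> Q != 0 ->
  exists2 R : 'M[F]_k.+1, R \in unitmx & (R *m Q *m R^T) 0 0 != 0.
Proof.
move=> hQ Q0.
have swap (Q' : 'M[F]_k.+1) i : Q' i i != 0 ->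
    exists2 R : 'M[F]_k.+1, R \in unitmx & (R *m Q' *m R^T) 0 0 != 0.
  move=> hi; exists (tperm_mx 0 i); first exact: unitmx_perm.
  by rewrite tr_tperm_mx -xrowE -xcolE !mxE tpermL.
have [[i hi] | diag0] := pselect (exists i, Q i i != 0); first exact: swap hi.
have d0 i : Q i i = 0.
  by apply: contrapT => h; apply: diag0; exists i; apply/eqP.
have [i [j hij]] : exists i j, Q i j != 0.
  apply: contrapT => h; case/negP: Q0; apply/eqP/matrixP=> i j; rewrite mxE.
  by apply: contrapT => h'; apply: h; exists i, j; apply/eqP.
have ij : i != j by apply: contraNneq hij => ->; rewrite d0.
pose E : 'M[F]_k.+1 := 1%:M + delta_mx i j.
have uE : E \in unitmx.
  have /mulmx1_unit[] // : E *m (1%:M - delta_mx i j) = 1%:M.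
  rewrite mulmxBr mulmx1 mulmxDl mul1mx mul_delta_mx_0 ?addr0 1?eq_sym //.
  by rewrite addrK.
have hii : (E *m Q *m E^T) i i != 0.
  have EQ l : (E *m Q) i l = Q i l + Q j l.
    rewrite mulmxDl mul1mx mxE; congr (_ + _); rewrite mxE (bigD1 j) //= mxE !eqxx mul1r.
    by rewrite big1 ?addr0 // => l' /negPf hl'; rewrite mxE hl' andbF mul0r.
  have -> : (E *m Q *m E^T) i i = Q i i + Q j i + (Q i j + Q j j).
    rewrite linearD /= trmx1 mulmxDr mulmx1 mxE EQ; congr (_ + _).
    rewrite mxE (bigD1 j) //= big1 ?addr0 => [|l /negPf hl]; rewrite !mxE.
      by rewrite !eqxx mulr1 -[RHS]EQ mxE.
    by rewrite hl andbF mulr0.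
  rewrite !d0 add0r addr0 -[in Q j i]hQ mxE -mulr2n -mulr_natl.
  by rewrite mulf_neq0.
have [R uR hR] := swap _ _ hii; exists (R *m E); first by rewrite unitmx_mul uR.
by rewrite trmx_mul !mulmxA in hR *.
Qed.

Lemma sym_split k (Q : 'M[F]_(1 + k)) : Q^T = Q -> Q != 0 ->
  exists P q (Q' : 'M[F]_k), [/\ P \in unitmx, q != 0, Q'^T = Q' &
    P *m Q *m P^T = block_mx q%:M 0 0 Q'].
Proof.
move=> hQ Q0; have [R uR hR] := sym_diag_neq0 hQ Q0.
have [X defX] : exists X : 'M[F]_(1 + k), X = R *m Q *m R^T by eexists.
rewrite -defX in hR; have hX : X^T = X by rewrite defX !trmx_mul trmxK hQ mulmxA.
pose q := X 0 0; pose c := dlsubmx X.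
have eX : X = block_mx q%:M c^T c (drsubmx X).
  rewrite -{1}[X]submxK; congr block_mx; last by rewrite /c trmx_dlsub hX.
  by rewrite [ulsubmx X]mx11_scalar !mxE (_ : lshift k (0 : 'I_1) = (0 : 'I_k.+1)) //; apply: val_inj.
have q0 : q != 0 by [].
pose K : 'M[F]_(1 + k) := block_mx 1%:M 0 (- q^-1 *: c) 1%:M.
exists (K *m R), q, (drsubmx X - q^-1 *: (c *m c^T)); split=> //.
- by rewrite unitmx_mul uR andbT /K unitmxE det_lblock !det1 mulr1 unitr1.
- by rewrite linearB linearZ /= trmx_mul trmxK trmx_drsub hX.
- have -> : K *m R *m Q *m (K *m R)^T = K *m X *m K^T.
    by rewrite defX trmx_mul !mulmxA.
  rewrite eX /K tr_block_mx !mulmx_block.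
  rewrite !(trmx1, trmx0, mul1mx, mulmx1, mul0mx, mulmx0, addr0) linearZ /=.
  rewrite mul_scalar_mx mul_mx_scalar !scalerA !mulrN mulfV // !scaleN1r !addNr mul0mx add0r.
  by rewrite -scalemxAl scaleNr addrC block_mxKdr.
Qed.

(** Two steps of orthogonalisation suffice, since only the two vectors exchanged in
    [odd_cyclic_prod5] have to be orthogonal to all the others. *)
Lemma sym_diag2 k (Q : 'M[F]_k.+2) : Q^T = Q -> Q \in unitmx ->
  exists2 P, P \in unitmx & let Q' := P *m Q *m P^T in
    [/\ Q' 0 0 != 0, Q' 1 1 != 0, forall j, j != 0 -> Q' 0 j = 0 &
        forall j, j != 1 -> Q' 1 j = 0].
Proof.
move=> hQ uQ.
have unit_neq0 l (M : 'M[F]_l.+1) : M \in unitmx -> M != 0.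
  by apply: contraTneq => ->; rewrite unitmxE det0 unitr0.
have [P [q0 [Q1 [uP hq0 hQ1 e1]]]] := @sym_split k.+1 Q hQ (unit_neq0 _ _ uQ).
have uQ1 : Q1 \in unitmx.
  have : P *m Q *m P^T \in unitmx by rewrite !unitmx_mul unitmx_tr uP uQ.
  by rewrite e1 !unitmxE det_lblock unitrM => /andP[].
have [P1 [q1 [Q2 [uP1 hq1 hQ2 e2]]]] := @sym_split k Q1 hQ1 (unit_neq0 _ _ uQ1).
pose R : 'M[F]_(1 + k.+1) := block_mx 1%:M 0 0 P1.
have uR : R \in unitmx by rewrite unitmxE det_lblock det1 mul1r -unitmxE.
exists (R *m P); first by rewrite unitmx_mul uP andbT.
move=> Q'; have -> : Q' = (block_mx q0%:M 0 0 (block_mx q1%:M 0 0 Q2 : 'M_(1 + k)) : 'M_(1 + k.+1)).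
  have -> : Q' = R *m (P *m Q *m P^T) *m R^T by rewrite /Q' trmx_mul !mulmxA.
  rewrite e1 /R tr_block_mx !mulmx_block.
  by rewrite !(trmx1, trmx0, mul1mx, mulmx1, mul0mx, mulmx0, addr0, add0r) e2.
have e0 : (0 : 'I_k.+2) = lshift k.+1 (0 : 'I_1) by apply: val_inj.
have e10 : (1 : 'I_k.+2) = @rshift 1 k.+1 (lshift k (0 : 'I_1)) by apply: val_inj.
rewrite e0 e10; split.
- by rewrite (@block_mxEul _ 1 k.+1 1 k.+1) mxE eqxx.
- by rewrite (@block_mxEdr _ 1 k.+1 1 k.+1) (@block_mxEul _ 1 k 1 k) mxE eqxx.
- move=> j; case: (@split_ordP 1 k.+1 j) => j' ->.
    by rewrite ord1 eqxx.
  by rewrite (@block_mxEur _ 1 k.+1 1 k.+1) mxE.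
- move=> j; case: (@split_ordP 1 k.+1 j) => j' ->.
    by rewrite (@block_mxEdl _ 1 k.+1 1 k.+1) mxE.
  rewrite (@block_mxEdr _ 1 k.+1 1 k.+1).
  case: (@split_ordP 1 k j') => j'' ->; first by rewrite ord1 eqxx.
  by rewrite (@block_mxEur _ 1 k 1 k) mxE.
Qed.
End SymmetricForm.

(** Frames are built by stacking blocks, so their number of rows equals [n] only propositionally. An
    invertible Gram matrix makes such a frame a basis. *)
Lemma full_frame_congr (F : fieldType) n (S u : 'M[F]_n) k (A : 'M[F]_(k, n)) (uA : 'M[F]_k) :
  k = n -> A *m S *m A^T \in unitmx -> A *m u = uA *m A ->
  (mx_prod4 (A *m S *m A^T) uA -> mx_prod4 S u) *
  (mx_prod5 (A *m S *m A^T) uA -> mx_prod5 S u).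
Proof.
move=> e; case: n / e in S u A * => ug hu.
have uA' : A \in unitmx by move: ug; rewrite !unitmx_mul => /andP[/andP[]].
have -> : uA = A *m u *m invmx A by rewrite hu mulmxK.
by split; [apply: mx_prod4_congr | apply: mx_prod5_congr].
Qed.

Lemma full_frame_stable (F : fieldType) n (S u : 'M[F]_n) k (A : 'M[F]_(k, n)) :
  k = n -> A *m S *m A^T \in unitmx -> exists uA, A *m u = uA *m A.
Proof.
move=> e; case: n / e in S u A * => ug.
have uA : A \in unitmx by move: ug; rewrite !unitmx_mul => /andP[/andP[]].
by exists (A *m u *m invmx A); rewrite mulmxKV.
Qed.

(** * Gluing two orthogonal stable frames *)

Section Gluing.
Variables (F : fieldType) (n : nat) (S u : 'M[F]_n).

Lemma mx_prod4_glue k l (A : 'M[F]_(k, n)) (C : 'M[F]_(l, n)) uA uC :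
  S^T = - S -> A *m S *m C^T = 0 -> A *m S *m A^T \in unitmx ->
  C *m S *m C^T \in unitmx -> row_full (A + C)%MS ->
  A *m u = uA *m A -> C *m u = uC *m C ->
  mx_prod4 (A *m S *m A^T) uA -> mx_prod4 (C *m S *m C^T) uC -> mx_prod4 S u.
Proof.
move=> hS AC gA gC full hA hC pA pC.
have CA : C *m S *m A^T = 0.
  have -> : C *m S *m A^T = - (A *m S *m C^T)^T.
    by rewrite !trmx_mul trmxK hS mulNmx mulmxN opprK mulmxA.
  by rewrite AC trmx0 oppr0.
have gram : col_mx A C *m S *m (col_mx A C)^T = block_mx (A *m S *m A^T) 0 0 (C *m S *m C^T).
  by rewrite gram_col_mx AC CA.
have ug : col_mx A C *m S *m (col_mx A C)^T \in unitmx.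
  by rewrite gram unitmxE det_lblock unitrM -!unitmxE gA.
have e : (k + l)%N = n.
  apply/eqP; rewrite eqn_leq; apply/andP; split.
    have := mxrankM_maxl (col_mx A C) (S *m (col_mx A C)^T).
    by rewrite mulmxA mxrank_unit // => h; apply: leq_trans h (rank_leq_col _).
  move: full; rewrite /row_full => /eqP {1}<-.
  have [h _] := mxrank_adds_leqif A C; apply: leq_trans h _; by apply: leq_add; apply: rank_leq_row.
have hu : col_mx A C *m u = block_mx uA 0 0 uC *m col_mx A C.
  by rewrite mul_col_mx mul_block_col !mul0mx addr0 add0r hA hC.
apply: (full_frame_congr e ug hu).1; rewrite gram.
exact: mx_prod4_block.
Qed.

End Gluing.

(** * Lagrangian frames adapted to the isometry *)

Section Parts.
Variables (F : fieldType) (n : nat) (S u : 'M[F]_n).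
Hypothesis two_neq0 : 2%:R != 0 :> F.
Hypothesis infF : infinite_set [set: F]%classic.
Hypotheses (S_skew : S^T = - S) (S_unit : S \in unitmx) (hu : mx_isom S u).

(** The name refers to the spaces [F[v] x], [v = u + u^-1], which provide such isotropic
    families. *)
Definition cyclic_part m (L : 'M[F]_(m, n)) : Prop :=
  [/\ L *m S *m L^T = 0, (L *m u *m S *m L^T)^T = L *m u *m S *m L^T &
      L *m u *m S *m L^T \in unitmx].

(** In the symplectic frame [L], [L'] the upper left block of [u] is the scalar matrix [x]. *)
Definition scalar_part m x (L L' : 'M[F]_(m, n)) : Prop :=
  [/\ L *m S *m L^T = 0, L' *m S *m L'^T = 0, L *m S *m L'^T = 1%:M &
      exists D, L *m u = x *: L + D *m L'].

(** An orthogonal grading for which [u + u^-1] is even and [u - u^-1] is odd. *)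
Definition reversible_part p q (V0 : 'M[F]_(p, n)) (V1 : 'M[F]_(q, n)) : Prop :=
  [/\ V0 *m S *m V1^T = 0, (V0 *m (u + invmx u) <= V0)%MS, (V1 *m (u + invmx u) <= V1)%MS,
      (V0 *m (u - invmx u) <= V1)%MS & (V1 *m (u - invmx u) <= V0)%MS].

Lemma form_trE p q (A : 'M[F]_(p, n)) (B : 'M[F]_(q, n)) :
  A *m S *m B^T = - (B *m S *m A^T)^T.
Proof. by rewrite !trmx_mul trmxK S_skew mulNmx mulmxN opprK mulmxA. Qed.

(** The rows of [L u - a L] are isotropic because [a Q] is symmetric, and they pair with [L] through
    [- Q]. Dividing by [- Q] gives a Lagrangian dual to [L]. *)
Lemma cyclic_frame m (L : 'M[F]_(m, n)) (a : 'M[F]_m) :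
  let Q := L *m u *m S *m L^T in cyclic_part L -> (a *m Q)^T = a *m Q ->
  let L' := - invmx Q *m (L *m u - a *m L) in
  [/\ L' *m S *m L'^T = 0, L *m S *m L'^T = 1%:M & L *m u = a *m L - Q *m L'].
Proof.
move=> Q [LL QT uQ] hQ L'.
have LuL : L *m S *m (L *m u)^T = - Q by rewrite form_trE QT.
have LuLu : L *m u *m S *m (L *m u)^T = 0.
  by rewrite trmx_mul !mulmxA -(mulmxA L) -(mulmxA L) hu LL.
pose N := L *m u - a *m L.
have LN : L *m S *m N^T = - Q.
  by rewrite linearB /= mulmxBr LuL trmx_mul !mulmxA LL mul0mx subr0.
have NN : N *m S *m N^T = 0.
  have e : L *m u *m S *m N^T = - (a *m Q).
    by rewrite linearB /= mulmxBr LuLu sub0r trmx_mul mulmxA -/Q -hQ trmx_mul QT.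
  rewrite {1}/N !mulmxBl e -(mulmxA a) -(mulmxA a) LN mulmxN opprK.
  by rewrite addNr.
have invQT : (invmx Q)^T = invmx Q by rewrite trmx_inv QT.
split.
- by rewrite /L' -/N trmx_mul !mulmxA -(mulmxA _ N) -(mulmxA _ (N *m S)) NN mulmx0 mul0mx.
- by rewrite /L' -/N mulNmx linearN /= trmx_mul mulmxN mulmxA LN invQT mulNmx opprK mulmxV.
- by rewrite /L' mulNmx mulmxN opprK mulKVmx // addrC subrK.
Qed.

Lemma frame_isom k (A : 'M[F]_(k, n)) uA : A *m u = uA *m A ->
  mx_isom (A *m S *m A^T) uA.
Proof.
move=> hA; rewrite /mx_isom -{2}hu !mulmxA -hA.
by rewrite -(mulmxA _ A^T) -trmx_mul -hA trmx_mul !mulmxA.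
Qed.

Lemma std_frame m (L L' : 'M[F]_(m, n)) :
  L *m S *m L^T = 0 -> L' *m S *m L'^T = 0 -> L *m S *m L'^T = 1%:M ->
  col_mx L L' *m S *m (col_mx L L')^T = std_form F m.
Proof.
move=> LL L'L' LL'; rewrite gram_col_mx LL L'L' LL' (form_trE L') LL'.
by rewrite trmx1.
Qed.

(** Pairing the expansion of [L u] with [L'] and with [L] identifies the upper blocks of [uA] as [a]
    and [D]; then [std_isom_LU] applies. *)
Lemma std_frame_LU m (L L' : 'M[F]_(m, n)) a D uA : a \in unitmx ->
  L *m S *m L^T = 0 -> L' *m S *m L'^T = 0 -> L *m S *m L'^T = 1%:M ->
  L *m u = a *m L + D *m L' -> col_mx L L' *m u = uA *m col_mx L L' ->
  exists K, [/\ K^T = K, (invmx a *m D)^T = invmx a *m D &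
    uA = lower_mx K *m levi_mx a *m upper_mx (invmx a *m D)].
Proof.
move=> ua LL L'L' LL' hL hA; have hs := std_frame LL L'L' LL'.
have := frame_isom hA; rewrite hs => iA.
have e : uA = block_mx a D (dlsubmx uA) (drsubmx uA).
  rewrite -{1}[uA]submxK; move: hA; rewrite -{1}[uA]submxK mul_col_mx mul_block_col.
  move=> /eq_col_mx[+ _]; rewrite hL => e1.
  have ea : a = ulsubmx uA.
    have := congr1 (fun X => X *m S *m L'^T) e1; rewrite !mulmxDl -!mulmxA.
    by rewrite [L *m (S *m _)]mulmxA LL' [L' *m (S *m _)]mulmxA L'L' !mulmx0 !mulmx1 !addr0.
  have eD : D = ursubmx uA.
    have := congr1 (fun X => X *m S *m L^T) e1; rewrite !mulmxDl -!mulmxA.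
    rewrite [L *m (S *m _)]mulmxA LL [L' *m (S *m _)]mulmxA !mulmx0 !add0r.
    by rewrite (form_trE L') LL' trmx1 !mulmxN !mulmx1 => /oppr_inj.
  by rewrite -ea -eD.
by rewrite e in iA *; apply: std_isom_LU.
Qed.

Lemma scalar_part_prod4 h x (L L' : 'M[F]_(h + h, n)) uA : x != 0 ->
  scalar_part x L L' -> col_mx L L' *m u = uA *m col_mx L L' ->
  mx_prod4 (col_mx L L' *m S *m (col_mx L L')^T) uA.
Proof.
move=> x0 [LL L'L' LL' [D hL]] hA.
have ux : x%:M \in @unitmx F (h + h) by rewrite unitmxE det_scalar unitrX ?unitfE.
rewrite -mul_scalar_mx in hL.
have [K [hK hD ->]] := std_frame_LU ux LL L'L' LL' hL hA.
by rewrite std_frame //; apply: even_scalar_prod4.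
Qed.

(** The size is odd and at least 3, which leaves room for a transposition of two basis vectors. *)
Lemma odd_cyclic_prod5 h (L : 'M[F]_(1 + (h.+1 + h.+1), n)) :
  (1 + (h.+1 + h.+1) + (1 + (h.+1 + h.+1)))%N = n -> cyclic_part L -> mx_prod5 S u.
Proof.
move=> en [LL QT uQ].
have [P uP /=] := sym_diag2 two_neq0 QT uQ.
set Q := P *m _ *m P^T => -[Q00 Q11 Q0 Q1].
pose L1 := P *m L.
have eQ : L1 *m u *m S *m L1^T = Q by rewrite /L1 trmx_mul /Q !mulmxA.
have L1part : cyclic_part L1.
  split; rewrite ?eQ.
  - by rewrite /L1 trmx_mul !mulmxA -!(mulmxA P) LL mul0mx mulmx0.
  - by rewrite /Q (trmx_mul _ P^T) (trmx_mul P) trmxK QT mulmxA.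
  - by rewrite /Q unitmx_mul unitmx_mul unitmx_tr uP uQ.
have [_ QT1 uQ1] := L1part; rewrite eQ in QT1 uQ1.
(* This ratio makes [T *m G *m Q] symmetric, where [T] swaps the first two
   basis vectors. *)
pose x := Q 0 0 / Q 1 1; have x0 : x != 0 by rewrite mulf_neq0 ?invr_eq0.
pose G : 'M[F]_(1 + (h.+1 + h.+1)) := corner_mx F h.+1 + x *: cocorner_mx F h.+1.
have defG : G = block_mx 1%:M 0 0 x%:M.
  rewrite /G /corner_mx /cocorner_mx scale_block_mx !scaler0 add_block_mx.
  by rewrite !addr0 add0r scalemx1.
have uG : G \in unitmx.
  by rewrite defG unitmxE det_lblock det1 mul1r det_scalar unitrX ?unitfE.
have GM (X : 'M[F]_(1 + (h.+1 + h.+1))) i j : (G *m X) i j = (if i == 0 then 1 else x) * X i j.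
  rewrite -[X]submxK defG mulmx_block !mul0mx !addr0 !add0r !mul1mx !mul_scalar_mx.
  case: (split_ordP i) => i' ->; case: (split_ordP j) => j' ->;
    rewrite ?(block_mxEul, block_mxEur, block_mxEdl, block_mxEdr) ?ord1 /= ?mul1r //.
    by rewrite mxE.
  by rewrite mxE.
pose T : 'M[F]_(1 + (h.+1 + h.+1)) := tperm_mx 0 1.
have TT : T *m T = 1%:M by rewrite /T -perm_mxM tperm2 perm_mx1.
have hT : T^T = T by rewrite /T tr_tperm_mx.
have T0 : T 0 0 = 0 by rewrite !mxE tpermL.
pose a := T *m G.
have TM (X : 'M[F]_(1 + (h.+1 + h.+1))) i j : (T *m X) i j = X (tperm 0 1 i) j.
  by rewrite /T -xrowE mxE.
have Qs i j : Q i j = Q j i by rewrite -{1}QT1 mxE.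
have aQ : (a *m Q)^T = a *m Q.
  apply/matrixP=> i j; rewrite mxE /a -mulmxA !TM !GM.
  have xQ : x * Q 1 1 = Q 0 0 by rewrite /x divfK.
  by case: tpermP => [-> | -> | /eqP i0 /eqP i1]; case: tpermP => [-> | -> | /eqP j0 /eqP j1];
    rewrite ?eqxx ?(negPf i0) ?(negPf j0) /= ?mul1r ?xQ // ?(Qs _ 0) ?(Qs _ 1) ?Q0 ?Q1 ?mulr0 // Qs.
have [L' [L'L' LL' hL]] : exists L' : 'M[F]_(1 + (h.+1 + h.+1), n),
    [/\ L' *m S *m L'^T = 0, L1 *m S *m L'^T = 1%:M & L1 *m u = a *m L1 - Q *m L'].
  by rewrite -eQ in aQ *; eexists; apply: cyclic_frame.
have ua : a \in unitmx by rewrite unitmx_mul unitmx_perm.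
have LL1 : L1 *m S *m L1^T = 0 by case: L1part.
have gram := std_frame LL1 L'L' LL'.
have ug := std_form_unit F (1 + (h.+1 + h.+1)); rewrite -gram in ug.
have [uA hA] := full_frame_stable u en ug.
rewrite -mulNmx in hL; have [K [hK hD e]] := std_frame_LU ua LL1 L'L' LL' hL hA.
apply: (full_frame_congr en ug hA).2; rewrite gram e.
apply: odd_swap_prod5 => //.
(* From [a *m D = - Q] comes [G *m D = - (T *m Q)], whose corner reads [D 0 0 = - Q 1 0]. This is
   zero because the two swapped vectors are orthogonal. *)
set D := invmx a *m - Q in hD *.
have : a *m D = - Q by rewrite /D mulKVmx.
rewrite /a => e0; clearbody D; have /matrixP/(_ 0 0) := congr1 (mulmx T) e0.
by rewrite !mulmxA TT mul1mx GM eqxx mul1r mulmxN [RHS]mxE TM tpermL Qs Q0 ?oppr0.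
Qed.

End Parts.

(** * Sum of a scalar part and a reversible part *)

Section Assembly.
Variables (F : fieldType) (n : nat) (S u : 'M[F]_n).
Hypothesis two_neq0 : 2%:R != 0 :> F.
Hypothesis infF : infinite_set [set: F]%classic.
Hypotheses (S_skew : S^T = - S) (S_unit : S \in unitmx) (hu : mx_isom S u).

Lemma half_sum k (A : 'M[F]_(k, n)) : A *m u = 2%:R^-1 *: (A *m (u + invmx u) + A *m (u - invmx u)).
Proof.
rewrite -mulmxDr addrACA [invmx u + _]addrC addNr addr0 -mulr2n -scaler_nat -scalemxAr.
by rewrite scalerA mulVf // scale1r.
Qed.

Lemma half_diff k (A : 'M[F]_(k, n)) :
  A *m invmx u = 2%:R^-1 *: (A *m (u + invmx u) - A *m (u - invmx u)).
Proof.
rewrite -mulmxBr opprB addrC addrA subrK -mulr2n -scaler_nat -scalemxAr.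
by rewrite scalerA mulVf // scale1r.
Qed.

(** The sign change on [V1] commutes with [u + u^-1] and anticommutes with [u - u^-1], hence
    conjugates [u] to its inverse. *)
Lemma reversible_frame p q (V0 : 'M[F]_(p, n)) (V1 : 'M[F]_(q, n)) :
  let C := col_mx V0 V1 in
  reversible_part S u V0 V1 -> row_free C ->
  exists2 uC, C *m u = uC *m C & mx_reversible (C *m S *m C^T) uC.
Proof.
move=> C [V01 /submxP[a ha] /submxP[d hd] /submxP[b hb] /submxP[c hc]] freeC.
have uu := mx_isom_unit S_unit hu.
pose uC := 2%:R^-1 *: block_mx a b c d.
have hC : C *m u = uC *m C.
  by rewrite mul_col_mx !half_sum ha hb hc hd -scalemxAl mul_block_col scale_col_mx [c *m _ + _]addrC.
pose i : 'M[F]_(p + q) := block_mx 1%:M 0 0 (- 1%:M).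
have hCV : i *m uC *m i *m C = C *m invmx u.
  rewrite [in RHS]/C [RHS]mul_col_mx !half_diff ha hb hc hd -scalemxAr -!scalemxAl.
  rewrite !mulmx_block mul_block_col -scale_col_mx.
  rewrite !(mul0mx, mulmx0, mul1mx, mulmx1, addr0, add0r, mulNmx, mulmxN, opprK, oppr0).
  by rewrite [- _ + _]addrC.
exists uC => //; split; first exact: (frame_isom hu hC).
exists i.
  split.
    rewrite /mx_isom /C gram_col_mx V01 (form_trE S_skew V1) V01 trmx0 oppr0.
    rewrite /i tr_block_mx !mulmx_block linearN /= !trmx0 !trmx1.
    by rewrite !(mul0mx, mulmx0, mul1mx, mulmx1, addr0, add0r, mulNmx, mulmxN, opprK, oppr0).
  rewrite /i !mulmx_block !(mul0mx, mulmx0, mul1mx, mulmx1, addr0, add0r, mulNmx, mulmxN, opprK, oppr0).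
  by rewrite -scalar_mx_block.
have [C' hC'] := row_freeP freeC.
rewrite -[LHS]mulmx1 -hC' mulmxA -(mulmxA _ uC) -hC mulmxA hCV mulmxKV //.
Qed.

(** [V0] and [V1] may have dependent rows, hence the passage to row bases. That these together form
    a free family with invertible Gram matrix follows from the nondegeneracy of [S] on the whole
    space. *)
Lemma assembly_prod4 h x (L L' : 'M[F]_(h + h, n)) p q (V0 : 'M[F]_(p, n)) (V1 : 'M[F]_(q, n)) :
  let A := col_mx L L' in
  x != 0 -> scalar_part S u x L L' -> (A *m u <= A)%MS ->
  reversible_part S u V0 V1 -> A *m S *m (col_mx V0 V1)^T = 0 ->
  row_full (A + col_mx V0 V1)%MS -> mx_prod4 S u.
Proof.
move=> A x0 hL /submxP[uA hA] [V01 h00 h11 h01 h10] AV full.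
have sub0 (k k' l l' : nat) (X : 'M[F]_(k, n)) (X' : 'M[F]_(k', n)) (Y : 'M[F]_(l, n)) (Y' : 'M[F]_(l', n)) :
    (X' <= X)%MS -> (Y' <= Y)%MS -> X *m S *m Y^T = 0 -> X' *m S *m Y'^T = 0.
  move=> /submxP[a ->] /submxP[b ->] e.
  by rewrite trmx_mul !mulmxA -(mulmxA a) -(mulmxA a) e mulmx0 mul0mx.
pose W0 := row_base V0; pose W1 := row_base V1; pose C := col_mx W0 W1.
have s0 : (W0 <= V0)%MS by rewrite eq_row_base.
have s1 : (W1 <= V1)%MS by rewrite eq_row_base.
have s0' : (V0 <= W0)%MS by rewrite eq_row_base.
have s1' : (V1 <= W1)%MS by rewrite eq_row_base.
have stab k k' l l' (X : 'M[F]_(k, n)) (X' : 'M[F]_(k', n)) (Y : 'M[F]_(l, n)) (Y' : 'M[F]_(l', n)) (M : 'M[F]_n) :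
    (X' <= X)%MS -> (Y <= Y')%MS -> (X *m M <= Y)%MS -> (X' *m M <= Y')%MS.
  by move=> hX hY le; apply: submx_trans (submxMr M hX) (submx_trans le hY).
have hW : reversible_part S u W0 W1.
  split; [exact: sub0 s0 s1 V01 | exact: stab s0 s0' h00 | exact: stab s1 s1' h11
         | exact: stab s0 s1' h01 | exact: stab s1 s0' h10].
have eC : (C :=: col_mx V0 V1)%MS.
  apply/eqmxP/andP; split; rewrite -!addsmxE; apply: addsmxS => //.
have AC : A *m S *m C^T = 0 by apply: sub0 AV; rewrite ?eC.
have CA : C *m S *m A^T = 0 by rewrite (form_trE S_skew) AC trmx0 oppr0.
have fullC : row_full (A + C)%MS by move: full; rewrite -!sub1mx => h1; apply: submx_trans h1 (addsmxS _ _); rewrite ?eC.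
have kill k (z : 'M[F]_(k, n)) : z *m S *m A^T = 0 -> z *m S *m C^T = 0 -> z = 0.
  move=> zA zC; have [X hX] := row_fullP fullC.
  have zX : z *m S *m (A + C)%MS^T = 0.
    have : z *m S *m (col_mx A C)^T = 0 by rewrite tr_col_mx mul_mx_row zA zC row_mx0.
    by apply: sub0 => //; rewrite addsmxE.
  have := congr1 (mulmx^~ X^T) zX; rewrite /= mul0mx -mulmxA -trmx_mul hX trmx1 mulmx1.
  by move/(congr1 (mulmx^~ (invmx S))); rewrite mulmxK // mul0mx.
have freeC : row_free C.
  rewrite -kermx_eq0; set K := kermx C; rewrite -[K]hsubmxK.
  have : K *m C = 0 by apply: mulmx_ker.
  rewrite -{1}[K]hsubmxK mul_row_col => /eqP; rewrite addr_eq0 => /eqP e.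
  (* This vector lies in both [W0] and [W1], so it is orthogonal to [W1], to [W0] and to [A]. *)
  have z0 : lsubmx K *m W0 = 0.
    apply: kill.
      by apply: sub0 (CA) => //; rewrite -addsmxE; apply: submx_trans (submxMl _ _) (addsmxSl _ _).
    rewrite tr_col_mx mul_mx_row -[RHS]row_mx0; congr row_mx; last first.
      by apply: sub0 V01 => //; apply: submx_trans (submxMl _ _) s0.
    rewrite e (form_trE S_skew).
    have -> : W0 *m S *m (- (rsubmx K *m W1))^T = 0.
      by apply: sub0 V01 => //; rewrite eqmx_opp; apply: submx_trans (submxMl _ _) s1.
    by rewrite trmx0 oppr0.
  move: e; rewrite z0 => /eqP; rewrite eq_sym oppr_eq0 => /eqP z1.
  have := row_base_free V0; rewrite -kermx_eq0 => /eqP k0.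
  have := row_base_free V1; rewrite -kermx_eq0 => /eqP k1.
  move/sub_kermxP: z0; move/sub_kermxP: z1; rewrite k0 k1 !submx0 => /eqP-> /eqP->.
  by rewrite row_mx0.
have [uC hC rC] := reversible_frame hW freeC.
have gC : C *m S *m C^T \in unitmx.
  rewrite -row_free_unit -kermx_eq0; set K := kermx _.
  have hK : K *m C *m S *m C^T = 0 by have := mulmx_ker (C *m S *m C^T); rewrite !mulmxA.
  have zz : K *m C = 0.
    by apply: kill => //; rewrite -(mulmxA K) -(mulmxA K) CA mulmx0.
  move: freeC; rewrite -kermx_eq0 => /eqP kC.
  by move/sub_kermxP: zz; rewrite kC submx0.
have [LL L'L' LL' _] := hL.
apply: (@mx_prod4_glue _ _ S u _ _ A C uA uC) => //.
- by rewrite /A std_frame // std_form_unit.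
- exact: (scalar_part_prod4 infF S_skew hu x0 hL hA).
- exact: mx_reversible_prod4.
Qed.

End Assembly.

(** * The action of u + u^-1 *)

Section PolynomialFactors.
Variable F : fieldType.
Implicit Types p a b c pi : {poly F}.

Lemma irreducible_factor p : (1 < size p)%N -> exists2 pi, irreducible_poly pi & pi %| p.
Proof.
elim: {p}(size p) {-2}p (leqnn (size p)) => [|k IH] p; first by case: (size p).
move=> le_k lt1; have [irr | red] := pselect (irreducible_poly p).
  by exists p.
have [q [q1 qp nqp]] : exists q : {poly F}, [/\ size q != 1%N, q %| p & ~~ (q %= p)].
  apply: contrapT => h; apply: red; split=> // q q1 qp.
  by apply: contrapT => /negP nqp; apply: h; exists q.
have p0 : p != 0 by rewrite -size_poly_gt0; apply: ltn_trans lt1.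
have q0 : q != 0 by apply: contraTneq qp => ->; rewrite dvd0p.
have ltq : (size q < size p)%N.
  by rewrite ltn_neqAle dvdp_leq // andbT; apply: contra nqp; rewrite dvdp_size_eqp.
have [||pi irr dv] := IH q; first by rewrite -ltnS; apply: leq_trans ltq le_k.
  by rewrite ltn_neqAle eq_sym q1 size_poly_gt0.
by exists pi => //; apply: dvdp_trans qp.
Qed.

Lemma irreducible_coprime pi c : irreducible_poly pi -> ~~ (pi %| c) -> coprimep pi c.
Proof.
move=> irr ndv; apply/coprimepP => d dpi dc; rewrite -size_poly_eq1.
by apply: contraNT ndv => d1; rewrite -(eqp_dvdl _ (irr.2 d d1 dpi)).
Qed.

Lemma irreducible_multiplicity pi p : irreducible_poly pi -> p != 0 ->
  exists k c, p = pi ^+ k * c /\ coprimep pi c.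
Proof.
move=> irr; elim: {p}(size p) {-2}p (leqnn (size p)) => [|m IH] p.
  by rewrite leqn0 size_poly_eq0 => ->.
move=> le_m p0; have [/dvdpP[q eq] | ndv] := boolP (pi %| p); last first.
  by exists 0%N, p; rewrite expr0 mul1r; split=> //; apply: irreducible_coprime.
have q0 : q != 0 by apply: contraNneq p0 => q0; rewrite eq q0 mul0r.
have pi0 : pi != 0 by apply: irredp_neq0.
have [||k [c [ec cc]]] := IH q => //.
  rewrite -ltnS; apply: leq_trans le_m; rewrite eq size_mul //.
  by case: irr => + _; move: (size q) (size pi) => i j; lia.
by exists k.+1, c; split=> //; rewrite eq ec mulrC exprS mulrA.
Qed.

(* The only minimal ideal of [F[X]/(pi ^ k.+1)] is generated by [pi ^ k]. *)
Lemma socle_multiple pi k a : irreducible_poly pi -> ~~ (pi ^+ k.+1 %| a) ->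
  exists b, pi ^+ k.+1 %| a * b - pi ^+ k.
Proof.
move=> irr ndv; have a0 : a != 0 by apply: contraNneq ndv => ->; rewrite dvdp0.
have [i [a' [ea cop]]] := irreducible_multiplicity irr a0.
have le_ik : (i <= k)%N.
  rewrite leqNgt; apply: contra ndv => lt; rewrite ea.
  by apply: dvdp_mulr; apply: dvdp_exp2l.
have /Bezout_eq1_coprimepP[[s t] /= e] : coprimep (pi ^+ k.+1) a' by apply: coprimep_expl.
exists (t * pi ^+ (k - i)).
have -> : a * (t * pi ^+ (k - i)) - pi ^+ k = - (pi ^+ k * s) * pi ^+ k.+1.
  have -> : a * (t * pi ^+ (k - i)) = pi ^+ k * (t * a').
    by rewrite ea -{2}(subnKC le_ik) exprD; ring.
  have -> : t * a' = 1 - s * pi ^+ k.+1 by rewrite -e addrC addKr.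
  by ring.
exact: dvdp_mulIr.
Qed.

Lemma coprime_inverse pi k c : coprimep pi c -> exists g, pi ^+ k %| g * c - 1.
Proof.
move=> cop.
have /Bezout_eq1_coprimepP[[s t] /= e] : coprimep (pi ^+ k) c by apply: coprimep_expl.
by exists t; rewrite -e opprD addrCA subrr addr0 -mulNr dvdp_mulIr.
Qed.

End PolynomialFactors.

(** * The symplectic space as a module over polynomials in [u + u^-1] *)

Section SymplecticModule.
Variables (F : fieldType) (n : nat) (S u : 'M[F]_n.+1).
Hypothesis two_neq0 : 2%:R != 0 :> F.
Hypotheses (S_skew : S^T = - S) (S_unit : S \in unitmx) (hu : mx_isom S u).
Implicit Types (x y z : 'rV[F]_n.+1) (a b c p : {poly F}).

Definition sform x y : F := (x *m S *m y^T) 0 0.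
Definition trace_op : 'M[F]_n.+1 := u + invmx u.
Definition skew_op : 'M[F]_n.+1 := u - invmx u.
Definition pact x a : 'rV[F]_n.+1 := x *m horner_mx trace_op a.

Local Notation v := trace_op.
Local Notation Y := skew_op.

Let uu : u \in unitmx. Proof. exact: mx_isom_unit hu. Qed.

Lemma sformDl x y z : sform (x + y) z = sform x z + sform y z.
Proof. by rewrite /sform !mulmxDl mxE. Qed.

Lemma sformZl k x y : sform (k *: x) y = k * sform x y.
Proof. by rewrite /sform -!scalemxAl mxE. Qed.

Lemma sform_skew x y : sform x y = - sform y x.
Proof. by rewrite /sform (form_trE S_skew) !mxE. Qed.

Lemma sformDr x y z : sform x (y + z) = sform x y + sform x z.
Proof. by rewrite sform_skew sformDl opprD -!sform_skew. Qed.

Lemma sformZr k x y : sform x (k *: y) = k * sform x y.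
Proof. by rewrite sform_skew sformZl -mulrN -sform_skew. Qed.

Lemma sform0l y : sform 0 y = 0.
Proof. by rewrite /sform !mul0mx mxE. Qed.

Lemma sform0r x : sform x 0 = 0.
Proof. by rewrite sform_skew sform0l oppr0. Qed.

Lemma sformNl x y : sform (- x) y = - sform x y.
Proof. by rewrite -scaleN1r sformZl mulN1r. Qed.

Lemma sformNr x y : sform x (- y) = - sform x y.
Proof. by rewrite -scaleN1r sformZr mulN1r. Qed.

Lemma self_opp (t : F) : t = - t -> t = 0.
Proof.
move/eqP; rewrite -subr_eq0 opprK -mulr2n -mulr_natl mulf_eq0 (negPf two_neq0) /=.
by move/eqP.
Qed.

Lemma sform_adj_u x y : sform (x *m u) y = sform x (y *m invmx u).
Proof.
have uV := mx_isomV S_unit hu.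
have e := mx_isom_tr S_unit uV; rewrite invmxK in e.
by rewrite /sform trmx_mul !mulmxA -(mulmxA x S) e !mulmxA.
Qed.

Lemma sform_adj_uV x y : sform (x *m invmx u) y = sform x (y *m u).
Proof. by rewrite sform_skew -sform_adj_u -sform_skew. Qed.

Lemma sform_v x y : sform (x *m v) y = sform x (y *m v).
Proof. by rewrite !mulmxDr sformDl sformDr sform_adj_u sform_adj_uV addrC. Qed.

Lemma sform_Y x y : sform (x *m Y) y = - sform x (y *m Y).
Proof.
by rewrite !mulmxDr !mulmxN sformDl sformDr sformNl sformNr sform_adj_u sform_adj_uV opprD opprK addrC.
Qed.

Lemma comm_uV : u *m invmx u = invmx u *m u.
Proof. by rewrite mulmxV ?mulVmx. Qed.

Lemma comm_vu : v *m u = u *m v.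
Proof. by rewrite mulmxDl mulmxDr comm_uV. Qed.

Lemma comm_vY : v *m Y = Y *m v.
Proof. by rewrite mulmxBr comm_vu -/v mulmxBl; congr (_ - _); rewrite mulmxDl mulmxDr comm_uV. Qed.

Lemma sqr_Y : Y *m Y = v *m v - 4%:R%:M.
Proof.
rewrite /skew_op /trace_op !(mulmxDl, mulmxDr, mulmxN, mulNmx) opprK mulmxV // mulVmx //.
have -> : 4%:R%:M = 1%:M + 1%:M + 1%:M + 1%:M :> 'M[F]_n.+1 by rewrite -!raddfD /=; congr (_%:M); ring.
rewrite !opprD !addrA; apply/matrixP=> i j; rewrite !mxE; ring.
Qed.

Lemma sqr_u : u *m u = v *m u - 1%:M.
Proof. by rewrite mulmxDl mulVmx // addrK. Qed.

Lemma double_u : 2%:R *: u = v + Y.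
Proof. by rewrite /v /Y addrACA [invmx u + _]addrC addNr addr0 scaler_nat. Qed.

Lemma pactM x a b : pact (pact x a) b = pact x (a * b).
Proof. by rewrite /pact -mulmxA mulmxE -rmorphM. Qed.

Lemma pactD x a b : pact x (a + b) = pact x a + pact x b.
Proof. by rewrite /pact rmorphD mulmxDr. Qed.

Lemma pactN x a : pact x (- a) = - pact x a.
Proof. by rewrite /pact rmorphN mulmxN. Qed.

Lemma pact1 x : pact x 1 = x.
Proof. by rewrite /pact rmorph1 mulmx1. Qed.

Lemma pactX x : pact x 'X = x *m v.
Proof. by rewrite /pact horner_mx_X. Qed.

Lemma pactC x k : pact x k%:P = k *: x.
Proof. by rewrite /pact horner_mx_C mul_mx_scalar. Qed.

Lemma pact_addl x y a : pact (x + y) a = pact x a + pact y a.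
Proof. by rewrite /pact mulmxDl. Qed.

Lemma pact_scale k x a : pact (k *: x) a = k *: pact x a.
Proof. by rewrite /pact scalemxAl. Qed.

Lemma pact0 a : pact 0 a = 0.
Proof. by rewrite /pact mul0mx. Qed.

Lemma pact_dvd x p a : pact x p = 0 -> p %| a -> pact x a = 0.
Proof. by move=> xp /dvdpP[q ->]; rewrite mulrC -pactM xp pact0. Qed.

Lemma pact_cong x p a b : pact x p = 0 -> p %| a - b -> pact x a = pact x b.
Proof. by move=> xp /(pact_dvd xp)/eqP; rewrite pactD pactN subr_eq0 => /eqP. Qed.

Lemma pact_Y x a : pact (x *m Y) a = pact x a *m Y.
Proof.
rewrite /pact -!mulmxA; congr (_ *m _).
by apply: comm_mx_horner; rewrite /comm_mx comm_vY.
Qed.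

Lemma pact_u x a : pact (x *m u) a = pact x a *m u.
Proof.
rewrite /pact -!mulmxA; congr (_ *m _).
by apply: comm_mx_horner; rewrite /comm_mx comm_vu.
Qed.

Lemma sform_act x y a : sform (pact x a) y = sform x (pact y a).
Proof.
elim/poly_ind: a x y => [|a k IH] x y.
  by rewrite /pact rmorph0 !mulmx0 sform0l sform0r.
by rewrite !pactD -!pactM !pactC !pactX sformDl sformDr sformZl sformZr sform_v IH -[pact (y *m v) a]/(pact _ a) -!pactX !pactM mulrC.
Qed.

(** Polynomials in [v] are self-adjoint and the form is skew, so [s (x c) x] equals its own
    opposite. *)
Lemma pact_isotropic x a b : sform (pact x a) (pact x b) = 0.
Proof.
have h c : sform (pact x c) x = 0 by apply: self_opp; rewrite {1}sform_act sform_skew.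
by rewrite -sform_act pactM h.
Qed.

End SymplecticModule.

(** * Cyclic subspaces *)

Section CyclicPieces.
Variables (F : fieldType) (n : nat) (S u : 'M[F]_n.+1).
Hypothesis two_neq0 : 2%:R != 0 :> F.
Hypotheses (S_skew : S^T = - S) (S_unit : S \in unitmx) (hu : mx_isom S u).
Implicit Types (x y z : 'rV[F]_n.+1) (a b c p : {poly F}).

Local Notation v := (trace_op u).
Local Notation Y := (skew_op u).
Local Notation sf := (sform S).
Local Notation pa := (pact u).

Let uu : u \in unitmx. Proof. exact: mx_isom_unit hu. Qed.

Lemma gramE k l (A : 'M[F]_(k, n.+1)) (B : 'M[F]_(l, n.+1)) i j :
  (A *m S *m B^T) i j = sf (row i A) (row j B).
Proof.
rewrite /sform -row_mul !mxE; apply: eq_bigr => t _.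
by rewrite !mxE.
Qed.

Lemma gram_mulE k l (A : 'M[F]_(k, n.+1)) (B : 'M[F]_(l, n.+1)) M i j :
  (A *m M *m S *m B^T) i j = sf (row i A *m M) (row j B).
Proof. by rewrite gramE row_mul. Qed.

Lemma gram_eq0P k l (A : 'M[F]_(k, n.+1)) (B : 'M[F]_(l, n.+1)) :
  A *m S *m B^T = 0 <->
  (forall x y, (x <= A)%MS -> (y <= B)%MS -> sf x y = 0).
Proof.
split=> [h x y /submxP[a ->] /submxP[b ->] | h].
  by rewrite /sform trmx_mul !mulmxA -(mulmxA a) -(mulmxA a) h mulmx0 mul0mx mxE.
by apply/matrixP=> i j; rewrite gramE mxE; apply: h; apply: row_sub.
Qed.

Lemma stable_act k (U : 'M[F]_(k, n.+1)) x a : (U *m v <= U)%MS -> (x <= U)%MS ->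
  (pa x a <= U)%MS.
Proof.
move=> st xU; elim/poly_ind: a => [|a k0 IH]; first by rewrite /pact rmorph0 mulmx0 sub0mx.
rewrite pactD -pactM pactX pactC addmx_sub ?scalemx_sub //.
by apply: submx_trans (submxMr _ IH) st.
Qed.

Lemma stable_inv k (U : 'M[F]_(k, n.+1)) : (U *m u <= U)%MS -> (U *m invmx u <= U)%MS.
Proof.
move=> st; have eU : (U *m u :=: U)%MS.
  by apply/eqmxP; rewrite -(mxrank_leqif_eq st) mxrankMfree // row_free_unit.
have /submxP[D hD] : (U <= U *m u)%MS by rewrite eU.
by rewrite {1}hD mulmxA mulmxK // submxMl.
Qed.

Lemma stable_trace k (U : 'M[F]_(k, n.+1)) : (U *m u <= U)%MS -> (U *m v <= U)%MS.
Proof. by move=> st; rewrite mulmxDr addmx_sub ?stable_inv. Qed.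

Lemma stable_skew k (U : 'M[F]_(k, n.+1)) : (U *m u <= U)%MS -> (U *m Y <= U)%MS.
Proof. by move=> st; rewrite mulmxBr addmx_sub ?eqmx_opp ?stable_inv. Qed.

(** By Cayley-Hamilton these powers already span [F[v] x]. *)
Definition krylov x : 'M[F]_n.+1 := \matrix_(j < n.+1) pa x 'X^j.

Lemma krylovP x y : (y <= krylov x)%MS <-> exists a, y = pa x a.
Proof.
split=> [/submxP[D ->] | [a ->]].
  exists (\sum_j D 0 j *: 'X^j); rewrite mulmx_sum_row /pact raddf_sum /= mulmx_sumr.
  by apply: eq_bigr => j _; rewrite rowK linearZ /= -scalemxAr.
have -> : pa x a = pa x (a %% char_poly v).
  apply: (pact_cong (p := char_poly v)).
    by rewrite /pact Cayley_Hamilton mulmx0.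
  by rewrite {1}(divp_eq a (char_poly v)) addrK dvdp_mulIr.
set r := a %% _; have szr : (size r <= n.+1)%N.
  rewrite -ltnS; have := size_char_poly v => <-.
  by rewrite ltn_modp -size_poly_eq0 size_char_poly.
have -> : r = \sum_(i < n.+1) r`_i *: 'X^i.
  by rewrite -poly_def; apply/polyP=> i; rewrite coef_poly; case: ltnP => // h;
     rewrite nth_default //; apply: leq_trans h.
rewrite /pact raddf_sum /= mulmx_sumr; apply: summx_sub => i _.
rewrite linearZ /= -scalemxAr scalemx_sub //.
by have := row_sub i (krylov x); rewrite rowK.
Qed.

Lemma krylov_stable x : (krylov x *m v <= krylov x)%MS.
Proof.
apply/row_subP=> i; rewrite row_mul rowK -pactX pactM.
by apply/krylovP; exists ('X^i * 'X).
Qed.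

Lemma krylov_id x : (x <= krylov x)%MS.
Proof. by apply/krylovP; exists 1; rewrite pact1. Qed.

(** The dimension [m] of the Lagrangian is recorded because its parity decides how the space is
    used. *)
Definition cyclic_type m (W : 'M[F]_n.+1) : Prop :=
  exists L : 'M[F]_(m, n.+1), cyclic_part S u L /\ (W :=: col_mx L (L *m u))%MS.

(** Since [2 u = v + Y] and [F[v] x] is isotropic, on it [s (u y) z] is half of [s (Y y) z].
    Nondegeneracy may thus be tested with [Y]. *)
Lemma krylov_cyclic_part x :
  (forall a, pa x a != 0 -> exists b, sf (pa x a *m Y) (pa x b) != 0) ->
  cyclic_part S u (row_base (krylov x)).
Proof.
move=> nondeg; set L := row_base _.
have LP y : (y <= L)%MS -> exists a, y = pa x a by rewrite eq_row_base => /krylovP.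
have LPr a : (pa x a <= L)%MS by rewrite eq_row_base; apply/krylovP; exists a.
have freeL : row_free L by apply: row_base_free.
clearbody L.
have LL : L *m S *m L^T = 0.
  by apply/gram_eq0P=> y z /LP[a ->] /LP[b ->]; apply: pact_isotropic.
have symL y z : (y <= L)%MS -> (z <= L)%MS -> sf (y *m u) z = sf (z *m u) y.
  move=> /LP[a ->] /LP[b ->]; apply/eqP; rewrite -subr_eq0.
  rewrite (sform_skew S_skew (pa x b *m u)) opprK sform_adj_u // -(sformDr S_skew) -mulmxDr [invmx u + u]addrC -/v.
  by rewrite -pactX pactM pact_isotropic.
have skewL y z : (y <= L)%MS -> (z <= L)%MS -> sf (y *m Y) z = 2%:R * sf (y *m u) z.
  move=> /LP[a ->] /LP[b ->]; rewrite -[RHS]sformZl scalemxAr double_u [in RHS]mulmxDr [RHS]sformDl.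
  by rewrite -pactX pactM pact_isotropic // add0r.
split=> //.
  by apply/matrixP=> i j; rewrite [LHS]mxE !gram_mulE symL ?row_sub.
rewrite -row_free_unit -kermx_eq0; apply/eqP/row_matrixP=> i; rewrite row0.
set c := row i _; pose z := c *m L.
have zL : (z <= L)%MS by apply: submxMl.
have e : c *m (L *m u *m S *m L^T) = 0.
  by apply/sub_kermxP; apply: row_sub.
have zz y : (y <= L)%MS -> sf (z *m Y) y = 0.
  move=> yL; rewrite skewL //; case/submxP: yL => d ->.
  have : z *m u *m S *m (d *m L)^T = 0.
    by have := congr1 (mulmx^~ d^T) e; rewrite /= mul0mx trmx_mul /z !mulmxA.
  by rewrite /sform => ->; rewrite mxE mulr0.
have z0 : z = 0.
  have [a ea] := LP _ zL; apply: contrapT => /eqP; rewrite ea => /nondeg[b].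
  by rewrite -ea zz ?eqxx.
move: freeL; rewrite -kermx_eq0 => /eqP k0.
by move/sub_kermxP: z0; rewrite k0 submx0 => /eqP.
Qed.

(** This rests on the quadratic relation [u^2 = v u - 1]. *)
Lemma trace_stable_closure k (L : 'M[F]_(k, n.+1)) : (L *m v <= L)%MS ->
  (col_mx L (L *m u) *m u <= col_mx L (L *m u))%MS.
Proof.
move=> st; rewrite mul_col_mx col_mx_sub -!addsmxE addsmxSr /=.
rewrite -mulmxA (sqr_u S_unit hu) mulmxBr mulmx1 mulmxA addmx_sub //.
  by apply: submx_trans (addsmxSr _ _); apply: submxMr.
by rewrite eqmx_opp addsmxSl.
Qed.

End CyclicPieces.

(** The matrix is antitriangular with nonzero antidiagonal: the coordinates of a kernel vector
    vanish in turn, the [i]-th one by looking at column [r - 1 - i]. The form [l.+1 = r] of the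
    hypothesis also covers [r = 0]. *)
Lemma hankel_unit (F : fieldType) r (h : nat -> F) :
  (forall l, (r <= l)%N -> h l = 0) -> (forall l, l.+1 = r -> h l != 0) ->
  \matrix_(i < r, j < r) h (i + j)%N \in unitmx.
Proof.
move=> h0 h1; rewrite -row_free_unit -kermx_eq0; apply/eqP/row_matrixP=> i0; rewrite row0.
set c := row i0 _; have : c *m \matrix_(i < r, j < r) h (i + j)%N = 0.
  by apply/sub_kermxP; apply: row_sub.
move: c => {}c hc.
have key : forall k (i : 'I_r), (i < k)%N -> c 0 i = 0.
  elim=> // k IH i; rewrite ltnS leq_eqVlt => /orP[/eqP ik|]; last exact: IH.
  have lt : (r.-1 - i < r)%N by have := ltn_ord i; lia.
  have /rowP/(_ (Ordinal lt)) := hc; rewrite !mxE (bigD1 i) //= big1 ?addr0.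
    rewrite mxE /= => /eqP; rewrite mulf_eq0 => /orP[/eqP //|].
    rewrite (negPf (h1 _ _)) //; have := ltn_ord i; lia.
  move=> j ji; rewrite mxE /=; have [lj | lj] := ltnP j k; first by rewrite IH // mul0r.
  rewrite h0 ?mulr0 //; have := ltn_ord i; have := ltn_ord j.
  have : (j : nat) != i by [].
  lia.
by apply/rowP=> i; rewrite mxE; apply: key (ltnSn i).
Qed.

(** * Unipotent pieces *)

Section OddUnipotent.
Variables (F : fieldType) (n : nat) (S u : 'M[F]_n.+1).
Hypothesis two_neq0 : 2%:R != 0 :> F.
Hypotheses (S_skew : S^T = - S) (S_unit : S \in unitmx) (hu : mx_isom S u).
Implicit Types (x y z : 'rV[F]_n.+1) (a b c p : {poly F}).

Local Notation v := (trace_op u).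
Local Notation Y := (skew_op u).
Local Notation sf := (sform S).
Local Notation pa := (pact u).

Variables (e : F) (r : nat).
Hypothesis e2 : e * e = 1.
Local Notation t := ('X - (2%:R * e)%:P).

Let actY := pact_Y S_unit hu.

Let e0 : e != 0. Proof. by apply: contraTneq (oner_neq0 F) => h; rewrite -e2 h mul0r eqxx. Qed.
Let four_neq0 : 4%:R != 0 :> F.
Proof. by have -> : 4%:R = 2%:R * 2%:R :> F by [ring]; rewrite mulf_neq0. Qed.

(** Where [t] is nilpotent, [Y^2 = t (t + 4 e)] is [t] times an invertible operator. The condition
    thus amounts to [Y^(2 r + 1)] killing [x], as for a Jordan block of odd size. *)
Definition odd_vector x : Prop := pa x (t ^+ r.+1) = 0 /\ pa (x *m Y) (t ^+ r) = 0.

Definition skew_form x y a : F := sf (pa x a *m Y) y.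

(** As the powers of [t] span all polynomials, this makes [Y F[v] x] orthogonal to [F[v] y]. *)
Definition skew_orth x y : Prop := forall j, skew_form x y (t ^+ j) = 0.

Lemma skew_formDl x y z a : skew_form (x + y) z a = skew_form x z a + skew_form y z a.
Proof. by rewrite /skew_form pact_addl mulmxDl sformDl. Qed.

Lemma skew_formZl k x z a : skew_form (k *: x) z a = k * skew_form x z a.
Proof. by rewrite /skew_form pact_scale -scalemxAl sformZl. Qed.

Lemma skew_form_sym x y a : skew_form x y a = skew_form y x a.
Proof.
rewrite /skew_form -!actY // sform_act // sform_Y // sform_skew // opprK.
by rewrite -actY.
Qed.

Lemma skew_formDr x y z a : skew_form z (x + y) a = skew_form z x a + skew_form z y a.
Proof. by rewrite skew_form_sym skew_formDl !(skew_form_sym _ z). Qed.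

Lemma skew_formZr k x z a : skew_form z (k *: x) a = k * skew_form z x a.
Proof. by rewrite skew_form_sym skew_formZl (skew_form_sym _ z). Qed.

Lemma skew_form_pa x y a b : skew_form x (pa y b) a = skew_form x y (a * b).
Proof. by rewrite /skew_form -sform_act // -actY // -actY // pactM actY. Qed.

Lemma skew_formD x y a b : skew_form x y (a + b) = skew_form x y a + skew_form x y b.
Proof. by rewrite /skew_form pactD mulmxDl sformDl. Qed.

Lemma skew_formC x y k a : skew_form x y (a * k%:P) = k * skew_form x y a.
Proof. by rewrite /skew_form -pactM pactC -scalemxAl sformZl. Qed.

(** [Y^2 = v^2 - 4] factors as [(v - 2 e) (v + 2 e)] because [e^2 = 1]. *)
Lemma pact_YY x a : pa x a *m Y *m Y = pa x (a * (t * (t + (4%:R * e)%:P))).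
Proof.
rewrite -[LHS]mulmxA (sqr_Y S_unit hu) mulmxBr mulmxA -!pactX !pactM mul_mx_scalar -(pactC u) pactM.
rewrite -pactN -pactD; congr (pa x _).
have -> : t * (t + (4%:R * e)%:P) = 'X * 'X - (4%:R * (e * e))%:P.
  by rewrite !polyCM; ring.
by rewrite e2 mulr1; ring.
Qed.

Lemma skew_form_Y x y a : skew_form x (y *m Y) a = - sf (pa x (a * (t * (t + (4%:R * e)%:P)))) y.
Proof. by rewrite -pact_YY [in RHS]sform_Y // opprK. Qed.

Lemma pact_high x j a : odd_vector x -> (r < j)%N -> pa x (t ^+ j * a) = 0.
Proof.
by move=> [h _] lt; rewrite -(subnKC lt) exprD -mulrA -pactM h pact0.
Qed.

Lemma pact_high_Y x j a : odd_vector x -> (r <= j)%N -> pa (x *m Y) (t ^+ j * a) = 0.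
Proof.
by move=> [_ h] le; rewrite -(subnKC le) exprD -mulrA -pactM h pact0.
Qed.

Lemma odd_vector_shift x y k i : odd_vector x -> odd_vector y ->
  odd_vector (x + k *: pa (y *m Y) (t ^+ i)).
Proof.
move=> [x1 x2] [y1 y2]; split.
  rewrite pact_addl x1 add0r pact_scale pactM mulrC -pactM actY // y1 mul0mx pact0.
  by rewrite scaler0.
rewrite mulmxDl pact_addl x2 add0r -scalemxAl pact_scale -actY // pactM mulrC -pactM.
by rewrite actY // y2 mul0mx pact0 scaler0.
Qed.

Lemma skew_form_high x y j a : odd_vector x -> (r <= j)%N -> skew_form x y (t ^+ j * a) = 0.
Proof. by move=> hx le; rewrite /skew_form -actY // pact_high_Y // sform0l. Qed.

Lemma skew_form_shift x y i j : odd_vector x ->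
  skew_form x (pa (y *m Y) (t ^+ i)) (t ^+ j) =
  - sf (pa x (t ^+ (i + j).+1 * (t + (4%:R * e)%:P))) y.
Proof.
move=> hx; rewrite skew_form_pa // skew_form_Y //; congr (- sf (pa x _) y).
by rewrite exprS exprD; ring.
Qed.

Lemma skew_form_shift2 y i j :
  skew_form (pa (y *m Y) (t ^+ i)) (pa (y *m Y) (t ^+ i)) (t ^+ j) =
  - skew_form y y (t ^+ (i + i + j).+1 * (t + (4%:R * e)%:P)).
Proof.
rewrite skew_form_pa // skew_form_Y //; congr (- _).
rewrite pactM actY // /skew_form; congr (sf (pa y _ *m Y) y).
by rewrite exprS !exprD; ring.
Qed.

Lemma skew_form_top x y i j : odd_vector x -> (r <= i + j)%N ->
  skew_form x (pa (y *m Y) (t ^+ i)) (t ^+ j) = 0.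
Proof.
by move=> hx le; rewrite skew_form_shift // pact_high ?sform0l ?oppr0.
Qed.

Lemma skew_form_last x y i j : odd_vector x -> (i + j).+1 = r ->
  skew_form x (pa (y *m Y) (t ^+ i)) (t ^+ j) = - (4%:R * e * sf (pa x (t ^+ r)) y).
Proof.
move=> hx h; rewrite skew_form_shift // h mulrDr -exprSr pactD -(mulr1 (t ^+ r.+1)).
by rewrite pact_high // add0r -pactM pactC sformZl.
Qed.

(* Descending induction on [j]: adding a multiple of [pa (y *m Y) (t ^+ i)] with
   [i + j + 1 = r] changes the form at [t ^+ j] without touching higher powers. *)
Lemma isotropic_adjust x y : odd_vector x -> odd_vector y -> sf (pa x (t ^+ r)) y != 0 ->
  exists z, let x' := x + z in
    [/\ odd_vector x', sf (pa x' (t ^+ r)) y != 0, skew_orth x' x' &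
        forall U : 'M[F]_n.+1, (U *m u <= U)%MS -> (x <= U)%MS -> (y <= U)%MS -> (x' <= U)%MS].
Proof.
move=> hx hy s0.
suff main d : (d <= r)%N -> exists x', [/\ odd_vector x', sf (pa x' (t ^+ r)) y != 0,
     forall j, (r - d <= j)%N -> skew_form x' x' (t ^+ j) = 0 &
     forall U : 'M[F]_n.+1, (U *m u <= U)%MS -> (x <= U)%MS -> (y <= U)%MS -> (x' <= U)%MS].
  have [x' [h1 h2 h3 h4]] := main r (leqnn r); exists (x' - x) => /=.
  rewrite addrC subrK; split=> // j; apply: h3; by rewrite subnn.
elim: d => [_ | d IH lt].
  exists x; split=> // j; rewrite subn0 => le.
  by rewrite -(mulr1 (t ^+ j)) skew_form_high.
have [x' [hx' s1 iso stU]] := IH (ltnW lt).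
pose J := (r - d.+1)%N; pose i := d; pose s := sf (pa x' (t ^+ r)) y.
have iJ : (i + J).+1 = r by rewrite /i /J; lia.
(* At [t ^+ J] the cross terms contribute [- 2 k (4 e s)] and the term quadratic in [k] vanishes, so
   the equation for [k] is linear. *)
pose k := skew_form x' x' (t ^+ J) / (2%:R * (4%:R * e * s)).
pose z := pa (y *m Y) (t ^+ i); exists (x' + k *: z); split.
- exact: odd_vector_shift.
- rewrite pact_addl pact_scale /z pactM [t ^+ i * _]mulrC; have [_ y2] := hy.
  by rewrite -pactM y2 pact0 scaler0 addr0.
- move=> j lej; have Jj : (J <= j)%N by [].
  rewrite !skew_formDl !skew_formDr !skew_formZl !skew_formZr.
  rewrite (skew_form_sym z x') skew_form_shift2 skew_form_high // 1?oppr0 ?mulr0 ?addr0; last first.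
    by rewrite /i; lia.
  move: Jj; rewrite leq_eqVlt => /orP[/eqP <- | ltJ].
    rewrite /z skew_form_last // -/s /k; field.
    by rewrite two_neq0 four_neq0 e0 s1.
  have l1 : (r - d <= j)%N by rewrite /J in ltJ; lia.
  have l2 : (r <= i + j)%N by rewrite /i /J in ltJ *; lia.
  by rewrite iso // /z skew_form_top // !mulr0 !addr0.
- move=> U stU' xU yU; apply: addmx_sub; first exact: stU.
  apply/scalemx_sub/stable_act; first exact: (stable_trace S_unit hu).
  by apply: submx_trans (submxMr _ yU) _; apply: (stable_skew S_unit hu).
Qed.

Lemma iso_poly x y j : skew_orth x y -> skew_form x y (t ^+ j * (t + (4%:R * e)%:P)) = 0.
Proof. by move=> h; rewrite mulrDr -exprSr skew_formD skew_formC !h mulr0 addr0. Qed.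

(** The same descending induction, now for the mixed form. Moving [y] along [pa (y *m Y) (t ^+ i)]
    preserves [skew_orth y y]: the cross terms vanish since [F[v] y] is isotropic, the quadratic one
    since [skew_orth y y] held before. *)
Lemma cross_adjust x y : odd_vector x -> odd_vector y -> sf (pa x (t ^+ r)) y != 0 ->
  skew_orth y y ->
  exists y', [/\ odd_vector y', sf (pa x (t ^+ r)) y' != 0, skew_orth y' y', skew_orth x y' &
    forall U : 'M[F]_n.+1, (U *m u <= U)%MS -> (y <= U)%MS -> (y' <= U)%MS].
Proof.
move=> hx hy s0 oy.
suff main d : (d <= r)%N -> exists y', [/\ odd_vector y', sf (pa x (t ^+ r)) y' != 0,
     skew_orth y' y', forall j, (r - d <= j)%N -> skew_form x y' (t ^+ j) = 0 &
     forall U : 'M[F]_n.+1, (U *m u <= U)%MS -> (y <= U)%MS -> (y' <= U)%MS].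
  have [y' [h1 h2 h3 h4 h5]] := main r (leqnn r); exists y'; split=> // j.
  by apply: h4; rewrite subnn.
elim: d => [_ | d IH lt].
  exists y; split=> // j; rewrite subn0 => le.
  by rewrite -(mulr1 (t ^+ j)) skew_form_high.
have [y' [hy' s1 iso cross stU]] := IH (ltnW lt).
pose J := (r - d.+1)%N; pose i := d; pose s := sf (pa x (t ^+ r)) y'.
have iJ : (i + J).+1 = r by rewrite /i /J; lia.
pose k := skew_form x y' (t ^+ J) / (4%:R * e * s).
pose z := pa (y' *m Y) (t ^+ i); exists (y' + k *: z); split.
- exact: odd_vector_shift.
- rewrite sformDr // sformZr // /z -sform_act // pactM -exprD.
  have -> : sf (pa x (t ^+ (r + i))) (y' *m Y) = - skew_form x y' (t ^+ (r + i)).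
    by rewrite /skew_form [in RHS]sform_Y // opprK.
  by rewrite -(mulr1 (t ^+ (r + i))) skew_form_high ?leq_addr // oppr0 mulr0 addr0.
- move=> j; rewrite !skew_formDl !skew_formDr !skew_formZl !skew_formZr iso.
  rewrite (skew_form_sym z y') skew_form_shift2 iso_poly // {1 2}/z skew_form_shift //.
  have -> : sf (pa y' (t ^+ (i + j).+1 * (t + (4%:R * e)%:P))) y' = 0.
    by rewrite -{2}[y'](pact1 u) pact_isotropic.
  by rewrite !(oppr0, mulr0, addr0).
- move=> j lej; have Jj : (J <= j)%N by [].
  rewrite skew_formDr skew_formZr /z.
  move: Jj; rewrite leq_eqVlt => /orP[/eqP <- | ltJ].
    rewrite skew_form_last // -/s /k; field.
    by rewrite four_neq0 e0 s1.
  have l1 : (r - d <= j)%N by rewrite /J in ltJ; lia.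
  have l2 : (r <= i + j)%N by rewrite /i /J in ltJ *; lia.
  by rewrite cross // skew_form_top // mulr0 addr0.
- move=> U stU' yU; apply: addmx_sub; first exact: stU.
  apply/scalemx_sub/stable_act; first exact: (stable_trace S_unit hu).
  by apply: submx_trans (submxMr _ (stU _ stU' yU)) _; apply: (stable_skew S_unit hu).
Qed.

End OddUnipotent.

Lemma sub_col_mxl (F : fieldType) n k l (A : 'M[F]_(k, n)) (B : 'M[F]_(l, n)) : (A <= col_mx A B)%MS.
Proof. by rewrite -addsmxE addsmxSl. Qed.

Lemma sub_col_mxr (F : fieldType) n k l (A : 'M[F]_(k, n)) (B : 'M[F]_(l, n)) : (B <= col_mx A B)%MS.
Proof. by rewrite -addsmxE addsmxSr. Qed.

(** * The piece generated by two odd vectors *)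

Section OddPiece.
Variables (F : fieldType) (n : nat) (S u : 'M[F]_n.+1).
Hypothesis two_neq0 : 2%:R != 0 :> F.
Hypotheses (S_skew : S^T = - S) (S_unit : S \in unitmx) (hu : mx_isom S u).
Implicit Types (x y z : 'rV[F]_n.+1) (a b c p : {poly F}).

Local Notation v := (trace_op u).
Local Notation Y := (skew_op u).
Local Notation sf := (sform S).
Local Notation pa := (pact u).

Let actY := pact_Y S_unit hu.
Let actu := pact_u S_unit hu.

(* Two descriptions of the same space: the scalar one is needed to restore the
   parity of a cyclic part, the reversible one lets several of them coexist. *)
Definition odd_type (W : 'M[F]_n.+1) : Prop :=
  exists (m : nat) (e : F) (L L' : 'M[F]_(m, n.+1)) (p q : nat) (V0 : 'M[F]_(p, n.+1)) (V1 : 'M[F]_(q, n.+1)),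
    [/\ odd m /\ e != 0, scalar_part S u e L L', reversible_part S u V0 V1,
        (W :=: col_mx L L')%MS & (W :=: col_mx V0 V1)%MS].

Variables (e : F) (r : nat) (x y : 'rV[F]_n.+1).
Hypothesis e2 : e * e = 1.
Local Notation t := ('X - (2%:R * e)%:P).
Hypotheses (hx : odd_vector u e r x) (hy : odd_vector u e r y).
Hypothesis s0 : sf (pa x (t ^+ r)) y != 0.
Hypotheses (oxx : skew_orth S u e x x) (oyy : skew_orth S u e y y)
  (oxy : skew_orth S u e x y).

Definition pow_rows z k : 'M[F]_(k, n.+1) := \matrix_(j < k) pa z (t ^+ j).

Lemma pow_rows_sub z k l (B : 'M[F]_(l, n.+1)) M :
  (forall j, (j < k)%N -> (pa z (t ^+ j) *m M <= B)%MS) -> (pow_rows z k *m M <= B)%MS.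
Proof. by move=> h; apply/row_subP=> j; rewrite row_mul rowK; apply: h. Qed.

Lemma pow_rows_mem z k j : (j < k)%N -> (pa z (t ^+ j) <= pow_rows z k)%MS.
Proof. by move=> lt; have := row_sub (Ordinal lt) (pow_rows z k); rewrite rowK. Qed.

Lemma pow_rows_gram z z' k l : pow_rows z k *m S *m (pow_rows z' l)^T =
  \matrix_(i, j) sf (pa z (t ^+ (i + j))) z'.
Proof.
apply/matrixP=> i j; rewrite gramE !rowK mxE -sform_act // pactM -exprD //.
Qed.

Lemma pow_rows_gram0 z z' k l : (forall j, sf (pa z (t ^+ j)) z' = 0) ->
  pow_rows z k *m S *m (pow_rows z' l)^T = 0.
Proof. by move=> h; rewrite pow_rows_gram; apply/matrixP=> i j; rewrite !mxE. Qed.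

Let oyx : skew_orth S u e y x. Proof. by move=> j; rewrite skew_form_sym. Qed.

Let orthY z z' j : skew_orth S u e z z' -> sf (pa (z *m Y) (t ^+ j)) z' = 0.
Proof. by move=> h; rewrite actY; apply: h. Qed.

Let orthYr z z' j : skew_orth S u e z z' -> sf (pa z (t ^+ j)) (z' *m Y) = 0.
Proof.
move=> h; have := h j; rewrite /skew_form sform_Y // => /eqP.
by rewrite oppr_eq0 => /eqP.
Qed.

Let iso0 z a : sf (pa z a) z = 0.
Proof. by rewrite -{2}[z](pact1 u) pact_isotropic. Qed.

Let half (s : F) : 2%:R * s = 0 -> s = 0.
Proof. by move/eqP; rewrite mulf_eq0 (negPf two_neq0) /= => /eqP. Qed.

Let e0 : e != 0. Proof. by apply: contraTneq (oner_neq0 F) => h; rewrite -e2 h mul0r eqxx. Qed.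
Let four_neq0 : 4%:R != 0 :> F.
Proof. by have -> : 4%:R = 2%:R * 2%:R :> F by [ring]; rewrite mulf_neq0. Qed.

Let double z z' : 2%:R * sf z (z' *m u) = sf z (z' *m v) + sf z (z' *m Y).
Proof. by rewrite -sformZr // scalemxAr double_u [in LHS]mulmxDr sformDr. Qed.

Lemma pact_mulX z j : pa z (t ^+ j * 'X) = pa z (t ^+ j.+1) + (2%:R * e) *: pa z (t ^+ j).
Proof. by rewrite exprSr -(pactC u) pactM -pactD -mulrDr subrK. Qed.

Lemma pact_mul4 z j : pa z (t ^+ j * (t + (4%:R * e)%:P)) =
  pa z (t ^+ j.+1) + (4%:R * e) *: pa z (t ^+ j).
Proof. by rewrite exprSr -(pactC u) pactM -pactD -mulrDr. Qed.

Let yp := y *m u + e *: y.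
Let xm := x *m u - e *: x.

Let s1 : sf (pa y (t ^+ r)) x != 0.
Proof. by rewrite sform_act // sform_skew // oppr_eq0. Qed.

(** A Lagrangian of odd dimension [2 r + 1]. The operator [u - e] maps it into the span of [odd_L0],
    since [(u - e) x = xm] and [(u - e) Y y = t yp]. *)
Definition odd_L : 'M[F]_(r.+1 + r, n.+1) := col_mx (pow_rows x r.+1) (pow_rows (y *m Y) r).
Definition odd_L0 : 'M[F]_(r.+1 + r, n.+1) := col_mx (pow_rows yp r.+1) (pow_rows xm r).

Lemma pow_rows_iso z k l : pow_rows z k *m S *m (pow_rows z l)^T = 0.
Proof. by apply: pow_rows_gram0 => j; apply: iso0. Qed.

Lemma odd_LL : odd_L *m S *m odd_L^T = 0.
Proof.
have e1 : pow_rows x r.+1 *m S *m (pow_rows (y *m Y) r)^T = 0.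
  by apply: pow_rows_gram0 => j; apply: orthYr.
rewrite gram_col_mx !pow_rows_iso (form_trE S_skew (pow_rows (y *m Y) r)) e1.
by rewrite trmx0 oppr0 block_mx0.
Qed.

(** The adjoint of [u + e] is [u^-1 + e], and [(u - e) (u^-1 + e) = e Y] as [e^2 = 1]; the mixed
    products therefore vanish by [skew_orth]. *)
Lemma odd_L0L0 : odd_L0 *m S *m odd_L0^T = 0.
Proof.
have key z z' j : skew_orth S u e z z' ->
    sf (pa (z *m u + e *: z) (t ^+ j)) (z' *m u - e *: z') = 0.
  move=> h; rewrite pact_addl pact_scale actu.
  set a := pa z _; rewrite sformDl sformZl sformDr // sformDr // -scaleN1r !sformZr //.
  rewrite sform_adj_u // mulmxK; last exact: mx_isom_unit hu.
  have e1 : sf (a *m u) z' = sf a (z' *m u).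
    rewrite sform_adj_u //; apply/eqP; rewrite -subr_eq0 -sformNr // -sformDr // -opprB.
    by rewrite sformNr // -mulmxBr (orthYr j h) oppr0.
  rewrite e1; transitivity ((1 - e * e) * sf a z'); first by ring.
  by rewrite e2 subrr mul0r.
have e1 : pow_rows yp r.+1 *m S *m (pow_rows xm r)^T = 0.
  by apply: pow_rows_gram0 => j; apply: key.
rewrite gram_col_mx !pow_rows_iso (form_trE S_skew (pow_rows xm r)) e1.
by rewrite trmx0 oppr0 block_mx0.
Qed.

(** Using [2 (u + e) = t + 4 e + Y] and [2 (u - e) = t + Y], the orthogonality relations leave two
    diagonal Hankel blocks, whose antidiagonal entries are, up to sign, [2 e] times the nonzero
    pairing of [t^r x] with [y]. *)
Lemma odd_LL0_unit : odd_L *m S *m odd_L0^T \in unitmx.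
Proof.
have g2 : pow_rows x r.+1 *m S *m (pow_rows xm r)^T = 0.
  apply: pow_rows_gram0 => j; apply: half.
  rewrite /xm sformDr // sformNr // sformZr // iso0 mulr0 subr0 double (orthYr j oxx) addr0.
  by rewrite -pactX -sform_act // pactM iso0.
have g3 : pow_rows (y *m Y) r *m S *m (pow_rows yp r.+1)^T = 0.
  apply: pow_rows_gram0 => j; apply: half.
  rewrite /yp sformDr // sformZr // (orthY j oyy) mulr0 addr0 double iso0 addr0.
  by rewrite -pactX -sform_act // pactM pact_mulX sformDl sformZl !(orthY _ oyy) mulr0 addr0.
rewrite gram_col_mx g2 g3 unitmxE det_lblock unitrM -!unitmxE; apply/andP; split.
  rewrite pow_rows_gram.
  have hE l : 2%:R * sf (pa x (t ^+ l)) yp = sf (pa x (t ^+ l * (t + (4%:R * e)%:P))) y.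
    rewrite /yp sformDr // mulrDr double (orthYr l oxy) addr0 sformZr // -pactX -sform_act //.
    by rewrite pactM pact_mulX pact_mul4 !sformDl !sformZl; ring.
  apply: (@hankel_unit _ r.+1 (fun l => sf (pa x (t ^+ l)) yp)) => l.
    by move=> lt; apply: half; rewrite hE (pact_high _ hx lt) sform0l.
  move=> [el]; have := hE l; rewrite pact_mul4 el; have [-> _] := hx.
  rewrite add0r sformZl => e1; apply: contraNneq s0 => e3.
  move/eqP: e1; rewrite e3 mulr0 eq_sym !mulf_eq0 (negPf e0) (negPf four_neq0) /=.
  by [].
rewrite pow_rows_gram.
have hE l : 2%:R * sf (pa (y *m Y) (t ^+ l)) xm = - sf (pa y (t ^+ l.+1 * (t + (4%:R * e)%:P))) x.
  rewrite /xm sformDr // sformNr // sformZr // (orthY l oyx) mulr0 subr0 double -pactX -sform_act //.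
  rewrite pactM pact_mulX sformDl sformZl !(orthY _ oyx) mulr0 !add0r.
  rewrite actY -[LHS]opprK -sform_Y // (pact_YY S_unit hu e2) exprSr -mulrA //.
apply: (@hankel_unit _ r (fun l => sf (pa (y *m Y) (t ^+ l)) xm)) => l.
  by move=> lt; apply: half; rewrite hE (@pact_high _ _ u e r y l.+1 _ hy lt) sform0l oppr0.
move=> el; have := hE l; rewrite pact_mul4 el; have [-> _] := hy.
rewrite add0r sformZl => e1; apply: contraNneq s1 => e3.
move/eqP: e1; rewrite e3 mulr0 eq_sym oppr_eq0 !mulf_eq0 (negPf e0) (negPf four_neq0) /=.
by [].
Qed.

Lemma odd_L_shift : (odd_L *m (u - e%:M) <= odd_L0)%MS.
Proof.
have uM z j : pa z (t ^+ j) *m (u - e%:M) = pa (z *m u - e *: z) (t ^+ j).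
  by rewrite mulmxBr mul_mx_scalar -actu -!scaleNr pact_addl pact_scale.
rewrite mul_col_mx col_mx_sub -!addsmxE; apply/andP; split.
  apply: pow_rows_sub => j; rewrite ltnS leq_eqVlt uM => /orP[/eqP -> | lt]; last first.
    by apply: submx_trans (addsmxSr _ _); apply: pow_rows_mem.
  (* Twice this vector is [t^(r + 1) x + t^r Y x], and [x] is odd. This is why [odd_L0] can do with
     [r] rows coming from [xm]. *)
  have -> : pa (x *m u - e *: x) (t ^+ r) = 0.
    have two_unit : 2%:R *: (x *m u - e *: x) = pa x t + x *m Y.
      by rewrite scalerBr scalemxAr double_u [in LHS]mulmxDr pactD pactX pactN pactC scalerA addrAC.
    apply: (scalerI two_neq0); rewrite scaler0 -pact_scale two_unit pact_addl pactM -exprS.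
    by have [-> ->] := hx; rewrite addr0.
  exact: sub0mx.
apply: pow_rows_sub => j lt; rewrite uM.
apply: submx_trans (addsmxSl _ _).
(* The identity behind this is [(u - e) (u - u^-1) = (u + u^-1 - 2 e) (u + e)]. *)
have -> : pa (y *m Y *m u - e *: (y *m Y)) (t ^+ j) = pa yp (t ^+ j.+1).
  rewrite exprS -pactM; congr (pa _ _); rewrite pactD pactX pactN pactC.
  have uu := mx_isom_unit S_unit hu.
  rewrite /yp /trace_op /skew_op !(mulmxDl, mulmxDr, mulmxN, mulNmx) -!scalemxAl mulmxKV // mulmxK //.
  set yuu := y *m u *m u; set yu := y *m u; set yV := y *m invmx u.
  transitivity (yuu + (1 - 2%:R * (e * e)) *: y - e *: yu + e *: yV).
    by rewrite e2; apply/rowP=> i; rewrite !mxE; ring.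
  by apply/rowP=> i; rewrite !mxE; ring.
by apply: pow_rows_mem.
Qed.

(** The grading is by [F[v] x + F[v] y] and its image under [Y]; oddness bounds the powers of [t]
    needed. *)
Definition odd_V0 : 'M[F]_(r.+1 + r.+1, n.+1) := col_mx (pow_rows x r.+1) (pow_rows y r.+1).
Definition odd_V1 : 'M[F]_(r + r, n.+1) := col_mx (pow_rows (x *m Y) r) (pow_rows (y *m Y) r).

Lemma odd_V0_mem z j : z = x \/ z = y -> (pa z (t ^+ j) <= odd_V0)%MS.
Proof.
move=> hz; have [lt | le] := ltnP j r.+1.
  rewrite -addsmxE; case: hz => ->.
    by apply: submx_trans (addsmxSl _ _); apply: pow_rows_mem.
  by apply: submx_trans (addsmxSr _ _); apply: pow_rows_mem.
rewrite -(mulr1 (t ^+ j)) (@pact_high _ _ u e r) ?sub0mx //.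
by case: hz => ->.
Qed.

Lemma odd_V1_mem z j : z = x \/ z = y -> (pa (z *m Y) (t ^+ j) <= odd_V1)%MS.
Proof.
move=> hz; have [lt | le] := ltnP j r.
  rewrite -addsmxE; case: hz => ->.
    by apply: submx_trans (addsmxSl _ _); apply: pow_rows_mem.
  by apply: submx_trans (addsmxSr _ _); apply: pow_rows_mem.
rewrite -(mulr1 (t ^+ j)) (@pact_high_Y _ _ u e r) ?sub0mx //.
by case: hz => ->.
Qed.

Lemma odd_reversible : reversible_part S u odd_V0 odd_V1.
Proof.
have vM z j : pa z (t ^+ j) *m v = pa z (t ^+ j * 'X) by rewrite -pactM pactX.
have YM z j : pa (z *m Y) (t ^+ j) *m Y = pa z (t ^+ j.+1 * (t + (4%:R * e)%:P)).
  by rewrite actY (pact_YY S_unit hu e2) exprSr mulrA.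
split.
- by rewrite gram_col_mx !pow_rows_gram0 ?block_mx0 // => j; apply: orthYr.
- rewrite -/v [X in (X <= _)%MS]mul_col_mx col_mx_sub; apply/andP; split;
    apply: pow_rows_sub => j _; rewrite vM pact_mulX; apply: addmx_sub;
    rewrite ?scalemx_sub // odd_V0_mem //; by [left | right].
- rewrite -/v [X in (X <= _)%MS]mul_col_mx col_mx_sub; apply/andP; split;
    apply: pow_rows_sub => j _; rewrite vM pact_mulX; apply: addmx_sub;
    rewrite ?scalemx_sub // odd_V1_mem //; by [left | right].
- rewrite -/Y [X in (X <= _)%MS]mul_col_mx col_mx_sub; apply/andP; split;
    apply: pow_rows_sub => j _; rewrite -actY odd_V1_mem //; by [left | right].
- rewrite -/Y [X in (X <= _)%MS]mul_col_mx col_mx_sub; apply/andP; split;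
    apply: pow_rows_sub => j _; rewrite YM pact_mul4; apply: addmx_sub;
    rewrite ?scalemx_sub // odd_V0_mem //; by [left | right].
Qed.

(** The symplectic frame [A] lies in the span of the graded family [V], is free, and both have
    [4 r + 2] rows; hence the two spans agree. *)
Lemma odd_piece : exists2 W : 'M[F]_n.+1, odd_type W &
  [/\ (x <= W)%MS, (W *m u <= W)%MS,
      forall z, (z <= W)%MS -> (forall z', (z' <= W)%MS -> sf z z' = 0) -> z = 0 &
      forall U : 'M[F]_n.+1, (U *m u <= U)%MS -> (x <= U)%MS -> (y <= U)%MS -> (W <= U)%MS].
Proof.
have le_rows : (r.+1 + r.+1 + (r + r) <= r.+1 + r + (r.+1 + r))%N by rewrite addnACA.
have uu := mx_isom_unit S_unit hu.
pose G := odd_L *m S *m odd_L0^T; have uG : G \in unitmx := odd_LL0_unit.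
pose L' := invmx G^T *m odd_L0.
have uGT : G^T \in unitmx by rewrite unitmx_tr.
have LL' : odd_L *m S *m L'^T = 1%:M.
  by rewrite trmx_mul mulmxA -/G trmx_inv trmxK mulmxV.
have L'L' : L' *m S *m L'^T = 0.
  by rewrite trmx_mul !mulmxA -(mulmxA _ odd_L0) -(mulmxA _ (odd_L0 *m S)) odd_L0L0 mulmx0 mul0mx.
have eL' : (L' :=: odd_L0)%MS by apply: eqmxMfull; rewrite row_full_unit unitmx_inv.
have [D hD] : exists D, odd_L *m u = e *: odd_L + D *m L'.
  have /submxP[D hD] : (odd_L *m (u - e%:M) <= L')%MS by rewrite eL' odd_L_shift.
  by exists D; rewrite -hD mulmxBr mul_mx_scalar addrC subrK.
have rev := odd_reversible; have [_ sv0 sv1 sY0 sY1] := rev.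
pose A := col_mx odd_L L'; pose V := col_mx odd_V0 odd_V1.
have Vv : (V *m v <= V)%MS.
  by rewrite mul_col_mx col_mx_sub (submx_trans sv0 (sub_col_mxl _ _)) (submx_trans sv1 (sub_col_mxr _ _)).
have VY : (V *m Y <= V)%MS.
  by rewrite mul_col_mx col_mx_sub (submx_trans sY0 (sub_col_mxr _ _)) (submx_trans sY1 (sub_col_mxl _ _)).
have Vu : (V *m u <= V)%MS by rewrite (half_sum u two_neq0) scalemx_sub // addmx_sub.
have V0V : (odd_V0 <= V)%MS by apply: sub_col_mxl.
have V1V : (odd_V1 <= V)%MS by apply: sub_col_mxr.
have xV : (x <= V)%MS.
  by apply: submx_trans V0V; have := @odd_V0_mem x 0 (or_introl erefl); rewrite expr0 pact1.
have yV : (y <= V)%MS.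
  by apply: submx_trans V0V; have := @odd_V0_mem y 0 (or_intror erefl); rewrite expr0 pact1.
have rowsV z k : (z <= V)%MS -> (pow_rows z k <= V)%MS.
  by move=> zV; rewrite -[pow_rows z k]mulmx1; apply: pow_rows_sub => j _; rewrite mulmx1; apply: stable_act.
have AV : (A <= V)%MS.
  rewrite col_mx_sub eL' !col_mx_sub !rowsV //.
  - by apply: addmx_sub; rewrite ?eqmx_opp ?scalemx_sub //; apply: submx_trans (submxMr _ xV) Vu.
  - by apply: addmx_sub; rewrite ?scalemx_sub //; apply: submx_trans (submxMr _ yV) Vu.
  - by apply: submx_trans (submxMr _ yV) VY.
have gA : A *m S *m A^T \in unitmx by rewrite std_frame ?odd_LL // std_form_unit.
have rA : (\rank V <= \rank A)%N.
  apply: leq_trans (rank_leq_row _) _.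
  have := mxrankM_maxl A (S *m A^T); rewrite (mulmxA A S) (mxrank_unit gA).
  exact: leq_trans le_rows.
have eAV : (A :=: V)%MS by apply/eqmxP; rewrite -(geq_leqif (mxrank_leqif_eq AV)).
exists <<V>>%MS.
  exists (r.+1 + r)%N, e, odd_L, L', (r.+1 + r.+1)%N, (r + r)%N, odd_V0, odd_V1.
  split=> //; rewrite ?genmxE //.
  - by split=> //; rewrite addSn /= addnn odd_double.
  - by split=> //; [exact: odd_LL | exists D].
  - by apply: eqmx_trans (genmxE _) _; apply: eqmx_sym.
  - exact: genmxE.
split.
- by rewrite genmxE.
- by rewrite genmxE (eqmxMr _ (genmxE V)).
- move=> z; rewrite genmxE -eAV => /submxP[c ->] h.
  have : c *m (A *m S *m A^T) = 0.
    rewrite !mulmxA; apply/gram_eq0P => z1 z2 /sub_rVP[k ->] z2A.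
    by rewrite sformZl h ?mulr0 // genmxE -eAV.
  by move/(congr1 (mulmx^~ (invmx (A *m S *m A^T)))); rewrite mulmxK // mul0mx => ->; rewrite mul0mx.
- move=> U stU xU yU; rewrite genmxE.
  have rowsU z k : (z <= U)%MS -> (pow_rows z k <= U)%MS.
    move=> zU; rewrite -[pow_rows z k]mulmx1; apply: pow_rows_sub => j _; rewrite mulmx1.
    by apply: stable_act => //; apply: (stable_trace S_unit hu).
  have YU z : (z <= U)%MS -> (z *m Y <= U)%MS.
    by move=> zU; apply: submx_trans (submxMr _ zU) (stable_skew S_unit hu stU).
  by rewrite !col_mx_sub !rowsU ?YU.
Qed.

End OddPiece.

(** * Orthogonal decomposition *)

Section Classification.
Variables (F : fieldType) (n : nat) (S u : 'M[F]_n.+1).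
Hypothesis two_neq0 : 2%:R != 0 :> F.
Hypotheses (S_skew : S^T = - S) (S_unit : S \in unitmx) (hu : mx_isom S u).
Implicit Types (x y z : 'rV[F]_n.+1) (a b c p : {poly F}) (U W : 'M[F]_n.+1).

Local Notation v := (trace_op u).
Local Notation Y := (skew_op u).
Local Notation sf := (sform S).
Local Notation pa := (pact u).

Let actY := pact_Y S_unit hu.

Definition regular W : Prop :=
  forall z, (z <= W)%MS -> (forall z', (z' <= W)%MS -> sf z z' = 0) -> z = 0.

Lemma regular_neq0 W x : regular W -> (x <= W)%MS -> x != 0 ->
  exists2 y, (y <= W)%MS & sf x y != 0.
Proof.
move=> reg xW x0; apply: contrapT => h; case/negP: x0; apply/eqP/reg => // y yW.
by apply: contrapT => /eqP nz; apply: h; exists y.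
Qed.

Lemma cyclic_regular m W : cyclic_type S u m W -> regular W.
Proof.
move=> [L [[LL QT uQ] eW]] z; rewrite eW => /submxP[D ->] h.
rewrite -[D]hsubmxK mul_row_col in h *.
set a := lsubmx D in h *; set b := rsubmx D in h *.
have orth k (M : 'M[F]_(k, n.+1)) : (M <= col_mx L (L *m u))%MS ->
    (a *m L + b *m (L *m u)) *m S *m M^T = 0.
  move=> le; apply/gram_eq0P => x y /sub_rVP[l ->] yM.
  by rewrite sformZl h ?mulr0 // eW; apply: submx_trans le.
have : a *m (L *m S *m L^T) + b *m (L *m u *m S *m L^T) = 0.
  by rewrite -(orth _ L (sub_col_mxl _ _)) !mulmxDl !mulmxA.
rewrite LL mulmx0 add0r => /(congr1 (mulmx^~ (invmx (L *m u *m S *m L^T)))).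
rewrite mulmxK // mul0mx => b0; rewrite b0 mul0mx addr0.
have : a *m (L *m S *m (L *m u)^T) = 0.
  by rewrite -(orth _ (L *m u) (sub_col_mxr _ _)) b0 mul0mx addr0 !mulmxA.
rewrite (form_trE S_skew) QT mulmxN => /eqP; rewrite oppr_eq0 => /eqP.
move/(congr1 (mulmx^~ (invmx (L *m u *m S *m L^T)))).
by rewrite mulmxK // mul0mx => ->; rewrite mul0mx.
Qed.

Lemma orth_sym k l (A : 'M[F]_(k, n.+1)) (B : 'M[F]_(l, n.+1)) :
  A *m S *m B^T = 0 -> B *m S *m A^T = 0.
Proof. by move=> h; rewrite (form_trE S_skew) h trmx0 oppr0. Qed.

(** [U'] is the orthogonal of [W] inside [U]; it is stable because [W] is stable under the adjoint
    [u^-1]. *)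
Lemma regular_split W U : (W <= U)%MS -> (W *m u <= W)%MS -> (U *m u <= U)%MS ->
  regular W -> regular U -> W != 0 ->
  exists U', [/\ (U' *m u <= U')%MS, regular U', W *m S *m U'^T = 0,
                (W + U' :=: U)%MS & (\rank U' < \rank U)%N].
Proof.
move=> WU stW stU regW regU W0.
pose B := row_base W; have eB : (B :=: W)%MS by apply: eq_row_base.
have uG : B *m S *m B^T \in unitmx.
  rewrite -row_free_unit -kermx_eq0; apply/eqP/row_matrixP => i; rewrite row0.
  set c := row i _; have hc : c *m (B *m S *m B^T) = 0.
    by apply/sub_kermxP; apply: row_sub.
  have z0 : c *m B = 0.
    apply: regW => [|z']; first by rewrite -eB submxMl.
    rewrite -eB => /submxP[d ->]; rewrite /sform trmx_mul.
    have -> : c *m B *m S *m (B^T *m d^T) = c *m (B *m S *m B^T) *m d^T by rewrite !mulmxA.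
    by rewrite hc mul0mx mxE.
  have := row_base_free W; rewrite -kermx_eq0 => /eqP k0.
  by move/sub_kermxP: z0; rewrite k0 submx0 => /eqP.
pose U' := (U :&: kermx (S *m B^T))%MS.
have inU' z : (z <= U')%MS <-> (z <= U)%MS /\ forall y, (y <= W)%MS -> sf z y = 0.
  rewrite sub_capmx; split.
    move=> /andP[-> /sub_kermxP h]; split=> // y; rewrite -eB => /submxP[d ->].
    by rewrite /sform trmx_mul !mulmxA -(mulmxA z) h mul0mx mxE.
  move=> [-> h] /=; apply/sub_kermxP; rewrite mulmxA; apply/gram_eq0P => x y /sub_rVP[k ->].
  by rewrite eB => yW; rewrite sformZl h ?mulr0.
have WU' : W *m S *m U'^T = 0.
  by apply/gram_eq0P => x y xW /inU'[_ h]; rewrite sform_skew // h // oppr0.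
have sumU : (W + U' :=: U)%MS.
  apply/eqmxP; rewrite addsmx_sub WU capmxSl /=; apply/row_subP => i.
  (* [z1] is the orthogonal projection of [z] onto [W], written with the Gram matrix of a basis. *)
  set z := row i U; pose z1 := z *m S *m B^T *m invmx (B *m S *m B^T) *m B.
  have z1W : (z1 <= W)%MS by rewrite -eB submxMl.
  rewrite -(subrK z1 z) addrC; apply: addmx_sub_adds => //.
  rewrite sub_capmx; apply/andP; split.
    by apply: addmx_sub; rewrite ?row_sub // eqmx_opp (submx_trans z1W).
  apply/sub_kermxP; rewrite mulmxBl !mulmxA.
  have -> : z1 *m S *m B^T = z *m S *m B^T by rewrite /z1 -(mulmxA _ B S) -(mulmxA _ (B *m S)) mulmxKV.
  by rewrite subrr.
exists U'; split=> //.
- apply/row_subP => i; rewrite row_mul; have /inU'[zU hz] := row_sub i U'.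
  apply: (proj2 (inU' _)); split; first by apply: submx_trans (submxMr _ zU) stU.
  move=> y yW; rewrite sform_adj_u //; apply: hz.
  by apply: submx_trans (submxMr _ yW) (stable_inv S_unit hu stW).
- move=> z zU' h; have /inU'[zU hz] := zU'; apply: regU => // y; rewrite -sumU => /sub_addsmxP[[d1 d2] ->] /=.
  by rewrite sformDr // hz ?submxMl // h ?submxMl // addr0.
- apply: rank_ltmx; rewrite /ltmx capmxSl /=; apply: contra W0 => UU'.
  apply/eqP/row_matrixP => i; rewrite row0; apply: regW; first exact: row_sub.
  have /inU'[_ h] : (row i W <= U')%MS by apply: submx_trans (row_sub i W) (submx_trans WU UU').
  exact: h.
Qed.

Definition kills U p : Prop := forall x, (x <= U)%MS -> pa x p = 0.

(** A substitute for the minimal polynomial: from the characteristic polynomial, an irreducible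
    factor is dropped as long as the quotient still kills [U]. *)
Lemma primary_factor U : U != 0 -> exists pi k c,
  [/\ irreducible_poly pi, coprimep pi c, kills U (pi ^+ k.+1 * c) & ~ kills U (pi ^+ k * c)].
Proof.
move=> U0.
suff main m p : (size p <= m)%N -> p != 0 -> kills U p -> exists pi k c,
  [/\ irreducible_poly pi, coprimep pi c, kills U (pi ^+ k.+1 * c) & ~ kills U (pi ^+ k * c)].
  apply: (main _ (char_poly v) (leqnn _)); first by rewrite -size_poly_eq0 size_char_poly.
  by move=> x _; rewrite /pact Cayley_Hamilton mulmx0.
elim: m p => [|m IH] p; first by rewrite leqn0 size_poly_eq0 => /eqP-> /eqP.
move=> le p0 kp.
have lt1 : (1 < size p)%N.
  rewrite ltnNge; apply: contra U0 => /size1_polyC ep.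
  have c0 : p`_0 != 0 by apply: contraNneq p0 => e; rewrite ep e.
  apply/eqP/row_matrixP => i; rewrite row0; have := kp _ (row_sub i U).
  by rewrite ep pactC => /eqP; rewrite scaler_eq0 (negPf c0) /= => /eqP.
have [pi irr dv] := irreducible_factor lt1.
have [[|k] [c [ep cop]]] := irreducible_multiplicity irr p0.
  move: dv; rewrite ep expr0 mul1r => dv.
  by move/coprimepP: cop => /(_ pi (dvdpp _) dv); rewrite -size_poly_eq1 => /eqP h; case: irr; rewrite h.
have [h | h] := pselect (kills U (pi ^+ k * c)); last by exists pi, k, c; rewrite -ep.
have pi0 := irredp_neq0 irr.
have q0 : pi ^+ k * c != 0 by apply: contraNneq p0 => e; rewrite ep exprS -mulrA e mulr0.
apply: (IH (pi ^+ k * c)) => //.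
rewrite -ltnS; apply: leq_trans le; rewrite ep exprS -mulrA (size_mul pi0 q0).
by case: irr => + _; case: (size pi) => [|[|i]] // _; rewrite addSn ltnS leq_addl.
Qed.

(** For [z = pa x c], killed by [pi ^+ k.+1], the form [s (Y y) y'] on [F[v] z] is nondegenerate as
    soon as it does not vanish on the socle, because every nonzero vector has a multiple generating
    the socle. *)
Lemma cyclic_piece U pi k c x : irreducible_poly pi -> coprimep pi c ->
  kills U (pi ^+ k.+1 * c) -> (U *m u <= U)%MS -> (x <= U)%MS ->
  sf (pa x (pi ^+ k * c) *m Y) x != 0 ->
  exists W, [/\ W != 0, (W <= U)%MS, (W *m u <= W)%MS & exists m, cyclic_type S u m W].
Proof.
move=> irr cop kU stU xU nz; pose z := pa x c.
have zk : pa z (pi ^+ k.+1) = 0 by rewrite pactM mulrC kU.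
(* [g] inverts [c] on [F[v] z], which compensates for the extra factor [c] in passing from [x] to
   [z]. *)
have [g hg] := coprime_inverse k.+1 cop.
have nondeg a : pa z a != 0 -> exists b, sf (pa z a *m Y) (pa z b) != 0.
  move=> za; have ndv : ~~ (pi ^+ k.+1 %| a).
    by apply: contra za => dv; rewrite (pact_dvd zk dv).
  have [b hb] := socle_multiple irr ndv; exists (b * g).
  have -> : sf (pa z a *m Y) (pa z (b * g)) = sf (pa (z *m Y) (a * (b * g))) z.
    by rewrite -sform_act // -actY pactM.
  have -> : pa (z *m Y) (a * (b * g)) = pa (z *m Y) (pi ^+ k * g).
    rewrite !actY; congr (_ *m _); apply: (pact_cong zk).
    have -> : a * (b * g) - pi ^+ k * g = (a * b - pi ^+ k) * g by ring.
    exact: dvdp_mulr.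
  have -> : sf (pa (z *m Y) (pi ^+ k * g)) z = sf (pa (x *m Y) (c * (pi ^+ k * g) * c)) x.
    by rewrite /z -sform_act // -actY !pactM mulrA.
  have <- : pa (x *m Y) (pi ^+ k * c) = pa (x *m Y) (c * (pi ^+ k * g) * c); last by rewrite actY.
  rewrite !actY; congr (_ *m _); apply: (pact_cong (kU _ xU)).
  have -> : pi ^+ k * c - c * (pi ^+ k * g) * c = - (pi ^+ k * c) * (g * c - 1) by ring.
  have /dvdpP[q ->] := hg.
  have -> : - (pi ^+ k * c) * (q * pi ^+ k.+1) = - (pi ^+ k * q) * (pi ^+ k.+1 * c) by ring.
  exact: dvdp_mulIr.
pose L := row_base (krylov u z).
have hL : cyclic_part S u L by apply: krylov_cyclic_part.
have Lv : (L *m v <= L)%MS.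
  have eL := eq_row_base (krylov u z).
  by rewrite eL (eqmxMr _ eL) krylov_stable.
have zL : (z <= L)%MS by rewrite eq_row_base krylov_id.
have LU : (L <= U)%MS.
  rewrite eq_row_base; apply/row_subP => i; rewrite rowK.
  by do 2!apply: stable_act (stable_trace S_unit hu stU) _.
exists <<col_mx L (L *m u)>>%MS; split.
- apply: contraNneq nz => W0.
  have : (z <= <<col_mx L (L *m u)>>)%MS by rewrite genmxE (submx_trans zL) ?sub_col_mxl.
  rewrite W0 submx0 => /eqP; rewrite mulrC -pactM -/z => ->.
  by rewrite pact0 mul0mx sform0l.
- by rewrite genmxE col_mx_sub LU (submx_trans (submxMr _ LU)).
- by rewrite genmxE (eqmxMr _ (genmxE _)) (trace_stable_closure S_unit hu).
- by exists (\rank (krylov u z)), L; split=> //; apply: genmxE.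
Qed.

End Classification.

(** * Existence of a cyclic or an odd piece *)

Section Decomposition.
Variables (F : fieldType) (n : nat) (S u : 'M[F]_n.+1).
Hypothesis two_neq0 : 2%:R != 0 :> F.
Hypotheses (S_skew : S^T = - S) (S_unit : S \in unitmx) (hu : mx_isom S u).
Implicit Types (x y z : 'rV[F]_n.+1) (a b c p : {poly F}) (U W : 'M[F]_n.+1).

Local Notation v := (trace_op u).
Local Notation Y := (skew_op u).
Local Notation sf := (sform S).
Local Notation pa := (pact u).

Let actY := pact_Y S_unit hu.

(** A nonzero [w = pa x (pi ^+ k * c)] is killed by [pi] and by [Y^2 = (v - 2) (v + 2)], so [pi]
    cannot be coprime to that product. *)
Lemma skew_kernel_factor U pi k c : irreducible_poly pi -> (U *m u <= U)%MS ->
  kills u U (pi ^+ k.+1 * c) -> ~ kills u U (pi ^+ k * c) ->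
  (forall x, (x <= U)%MS -> pa x (pi ^+ k * c) *m Y = 0) ->
  exists2 e : F, e * e = 1 & pi %= 'X - (2%:R * e)%:P.
Proof.
move=> irr stU kU nkU kY.
have dvd_lin (e : F) : pi %| 'X - (2%:R * e)%:P -> pi %= 'X - (2%:R * e)%:P.
  by move=> dv; apply: (irredp_XsubC _).2 => //; case: irr => h _; rewrite neq_ltn h orbT.
have [dv | ndv] := boolP (pi %| 'X - (2%:R * 1)%:P).
  by exists 1; [rewrite mulr1 | apply: dvd_lin].
have [dv' | ndv'] := boolP (pi %| 'X - (2%:R * -1)%:P).
  by exists (-1); [rewrite mulrNN mulr1 | apply: dvd_lin].
case: nkU => x xU; set w := pa x _.
have wpi : pa w pi = 0 by rewrite pactM mulrAC -exprSr kU.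
have wY : w *m Y *m Y = 0 by rewrite kY // mul0mx.
have w4 : pa w (('X - (2%:R * 1)%:P) * ('X - (2%:R * 1)%:P + (4%:R * 1)%:P)) = 0.
  by rewrite -[_ * _]mul1r -(pact_YY S_unit hu (mulr1 1)) pact1.
clearbody w.
have cop : coprimep pi (('X - (2%:R * 1)%:P) * ('X - (2%:R * 1)%:P + (4%:R * 1)%:P)).
  rewrite coprimepMr !irreducible_coprime //.
  have -> : 'X - (2%:R * 1)%:P + (4%:R * 1)%:P = 'X - (2%:R * -1)%:P :> {poly F}.
    by rewrite -addrA -polyCN -polyCD -polyCN; congr (_ + _%:P); ring.
  by [].
have /Bezout_eq1_coprimepP[[s q] /= e] := cop.
rewrite -(pact1 u w) -e pactD [s * _]mulrC [q * _]mulrC -(pactM u w pi) wpi.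
by rewrite -(pactM u w _ q) w4 !pact0 addr0.
Qed.

(** Multiplication by [c] leads into the part where [t] is nilpotent, and the hypothesis on [Y]
    makes the vectors odd. A pair with nonzero pairing through [t ^+ k] is then corrected three
    times: [x] against itself, [y] against itself, [y] against [x]. *)
Lemma odd_unipotent_piece U e k c : e * e = 1 -> coprimep ('X - (2%:R * e)%:P) c ->
  (U *m u <= U)%MS -> regular S U ->
  kills u U (('X - (2%:R * e)%:P) ^+ k.+1 * c) ->
  ~ kills u U (('X - (2%:R * e)%:P) ^+ k * c) ->
  (forall x, (x <= U)%MS -> pa x (('X - (2%:R * e)%:P) ^+ k * c) *m Y = 0) ->
  exists W, [/\ W != 0, (W <= U)%MS, (W *m u <= W)%MS, regular S W & odd_type S u W].
Proof.
move=> e2; set t := 'X - _ => cop stU regU kU nkU kY.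
have stV := stable_trace S_unit hu stU.
have [x0 x0U nz] : exists2 x, (x <= U)%MS & pa x (t ^+ k * c) != 0.
  apply: contrapT => h; apply: nkU => x xU; apply: contrapT => nz.
  by apply: h; exists x => //; apply/eqP.
have [y0 y0U s0] : exists2 y, (y <= U)%MS & sf (pa x0 (t ^+ k * c)) y != 0.
  by apply: (regular_neq0 regU) => //; apply: stable_act.
have [g hg] := coprime_inverse k.+1 cop.
have key x : (x <= U)%MS -> pa x (t ^+ k * c * (g * c)) = pa x (t ^+ k * c).
  move=> xU; apply: (pact_cong (kU _ xU)); have /dvdpP[q eq] := hg.
  have -> : t ^+ k * c * (g * c) - t ^+ k * c = t ^+ k * c * (g * c - 1) by ring.
  rewrite eq; have -> : t ^+ k * c * (q * t ^+ k.+1) = t ^+ k * q * (t ^+ k.+1 * c) by ring.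
  exact: dvdp_mulIr.
have odd_c x a : (x <= U)%MS -> odd_vector u e k (pa x (c * a)).
  move=> xU; split; rewrite -/t.
    by rewrite pactM mulrAC [c * _]mulrC -pactM kU // pact0.
  have -> : pa (pa x (c * a) *m Y) (t ^+ k) = pa (pa x (t ^+ k * c) *m Y) a.
    by rewrite !actY !pactM; congr (pa x _ *m Y); ring.
  by rewrite kY // pact0.
have hx : odd_vector u e k (pa x0 (c * 1)) by apply: odd_c.
have hy : odd_vector u e k (pa y0 (c * g)) by apply: odd_c.
set x1 := pa x0 _ in hx; set y1 := pa y0 _ in hy.
have x1U : (x1 <= U)%MS by apply: stable_act.
have y1U : (y1 <= U)%MS by apply: stable_act.
have s1 : sf (pa x1 (t ^+ k)) y1 != 0.
  rewrite /x1 /y1 -sform_act // !pactM.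
  have -> : c * 1 * (t ^+ k * (c * g)) = t ^+ k * c * (g * c) by ring.
  by rewrite key.
have [dx [hx2 s2 ox2 x2U]] := isotropic_adjust two_neq0 S_skew S_unit hu e2 hx hy s1.
set x2 := x1 + dx in hx2 s2 ox2 x2U.
have s2' : sf (pa y1 (t ^+ k)) x2 != 0 by rewrite sform_act // sform_skew // oppr_eq0.
have [dy [hy2 s3 oy2 y2U]] := isotropic_adjust two_neq0 S_skew S_unit hu e2 hy hx2 s2'.
set y2 := y1 + dy in hy2 s3 oy2 y2U.
have s3' : sf (pa x2 (t ^+ k)) y2 != 0 by rewrite sform_act // sform_skew // oppr_eq0.
have [y3 [hy3 s4 oy3 oxy3 y3U]] := cross_adjust two_neq0 S_skew S_unit hu e2 hx2 hy2 s3' oy2.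
have [W hW [xW stW regW WU]] := odd_piece two_neq0 S_skew S_unit hu e2 hx2 hy3 s4 ox2 oy3 oxy3.
have x2U' := x2U _ stU x1U y1U.
exists W; split=> //.
- apply: contraNneq s4 => W0; move: xW; rewrite W0 submx0 => /eqP ->.
  by rewrite pact0 sform0l.
- by apply: WU => //; apply: y3U => //; apply: y2U.
Qed.

(** Either the quadratic form [s (Y pi^k c x) x] takes a nonzero value on [U], which yields a cyclic
    piece, or by polarisation and regularity [Y pi^k c] vanishes on [U], which yields an odd one. *)
Lemma exists_piece U : (U *m u <= U)%MS -> regular S U -> U != 0 ->
  exists W, [/\ W != 0, (W <= U)%MS, (W *m u <= W)%MS, regular S W &
    (exists m, cyclic_type S u m W) \/ odd_type S u W].
Proof.
move=> stU regU U0.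
have [pi [k [c [irr cop kU nkU]]]] := primary_factor u U0.
have [[x xU nz] | none] :=
  pselect (exists2 x, (x <= U)%MS & sf (pa x (pi ^+ k * c) *m Y) x != 0).
  have [W [W0 WU stW [m hW]]] := cyclic_piece two_neq0 S_skew S_unit hu irr cop kU stU xU nz.
  exists W; split=> //; first exact: (cyclic_regular S_skew hW).
  by left; exists m.
have iso x : (x <= U)%MS -> skew_form S u x x (pi ^+ k * c) = 0.
  move=> xU; apply: contrapT => /eqP nz; apply: none; by exists x.
have stV := stable_trace S_unit hu stU.
have kY x : (x <= U)%MS -> pa x (pi ^+ k * c) *m Y = 0.
  move=> xU; apply: regU => [|y yU].
    apply: submx_trans (submxMr _ (stable_act _ stV xU)) _.
    exact: (stable_skew S_unit hu).
  have := iso (x + y) (addmx_sub xU yU).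
  rewrite skew_formDl !(skew_formDr S_skew S_unit hu) iso // iso // add0r addr0.
  rewrite [X in _ + X](skew_form_sym S_skew S_unit hu) => /eqP; rewrite -mulr2n -mulr_natl mulf_eq0.
  by rewrite (negPf two_neq0) /= => /eqP.
have [e e2 epi] := skew_kernel_factor irr stU kU nkU kY.
set t := 'X - _ in epi.
have ek j : pi ^+ j * c %= t ^+ j * c by apply: eqp_mulr; apply: eqp_exp.
have kt a a' : a %= a' -> kills u U a -> kills u U a'.
  by move=> /andP[dv _] ka x xU; apply: (pact_dvd (ka x xU)).
have [W [W0 WU stW regW hW]] : exists W, [/\ W != 0, (W <= U)%MS, (W *m u <= W)%MS, regular S W & odd_type S u W].
  apply: (@odd_unipotent_piece U e k c) => //.
  - by rewrite -/t -(eqp_coprimepl _ epi).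
  - exact: kt kU.
  - by move=> h; apply: nkU; apply: kt h; rewrite eqp_sym.
  - move=> x xU; rewrite -actY; apply: (@pact_dvd _ _ _ _ (pi ^+ k * c)); first by rewrite actY kY.
    by case/andP: (ek k).
by exists W; split=> //; right.
Qed.

End Decomposition.

(** * Sums of pieces and the parity argument *)

Section OrthogonalSum.
Variables (F : fieldType) (n : nat) (S u : 'M[F]_n.+1).
Hypothesis two_neq0 : 2%:R != 0 :> F.
Hypothesis infF : infinite_set [set: F]%classic.
Hypotheses (S_skew : S^T = - S) (S_unit : S \in unitmx) (hu : mx_isom S u).
Implicit Types (U W : 'M[F]_n.+1).

Definition reversible_type W : Prop :=
  exists (p q : nat) (V0 : 'M[F]_(p, n.+1)) (V1 : 'M[F]_(q, n.+1)),
    reversible_part S u V0 V1 /\ (W :=: col_mx V0 V1)%MS.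

Definition orthogonal W W' : Prop := W *m S *m W'^T = 0.

Lemma orthogonalS k k' l l' (A : 'M[F]_(k, n.+1)) (A' : 'M[F]_(k', n.+1))
    (B : 'M[F]_(l, n.+1)) (B' : 'M[F]_(l', n.+1)) :
  (A' <= A)%MS -> (B' <= B)%MS -> A *m S *m B^T = 0 -> A' *m S *m B'^T = 0.
Proof.
by move=> hA hB /gram_eq0P h; apply/gram_eq0P => x y xA yB; apply: h;
  [apply: submx_trans hA | apply: submx_trans hB].
Qed.

Lemma col_mxS k k' l l' (A : 'M[F]_(k, n.+1)) (A' : 'M[F]_(k', n.+1))
    (B : 'M[F]_(l, n.+1)) (B' : 'M[F]_(l', n.+1)) :
  (A <= A')%MS -> (B <= B')%MS -> (col_mx A B <= col_mx A' B')%MS.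
Proof.
by move=> hA hB; rewrite col_mx_sub (submx_trans hA (sub_col_mxl _ _))
  (submx_trans hB (sub_col_mxr _ _)).
Qed.

Lemma addsmx_col4 W W' a b c d (A : 'M[F]_(a, n.+1)) (B : 'M[F]_(b, n.+1))
    (C : 'M[F]_(c, n.+1)) (D : 'M[F]_(d, n.+1)) :
  (W :=: col_mx A B)%MS -> (W' :=: col_mx C D)%MS ->
  (W + W' :=: col_mx (col_mx A C) (col_mx B D))%MS.
Proof.
move=> eW eW'; apply: eqmx_trans (adds_eqmx eW eW') _.
apply/eqmxP/andP; split; last first.
  rewrite !col_mx_sub; do !(apply/andP; split);
    [apply: submx_trans (addsmxSl _ _) | apply: submx_trans (addsmxSr _ _)
    | apply: submx_trans (addsmxSl _ _) | apply: submx_trans (addsmxSr _ _)];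
    by rewrite ?sub_col_mxl ?sub_col_mxr.
by rewrite addsmx_sub !col_mxS ?sub_col_mxl ?sub_col_mxr.
Qed.

Lemma cyclic_add m m' W W' : cyclic_type S u m W -> cyclic_type S u m' W' ->
  orthogonal W W' -> cyclic_type S u (m + m') (W + W')%MS.
Proof.
move=> [L [[LL QT uQ] eW]] [L' [[LL' QT' uQ'] eW']] ort.
exists (col_mx L L'); split; last by rewrite mul_col_mx; apply: addsmx_col4.
have sub1 : (L <= W)%MS by rewrite eW sub_col_mxl.
have sub2 : (L *m u <= W)%MS by rewrite eW sub_col_mxr.
have sub1' : (L' <= W')%MS by rewrite eW' sub_col_mxl.
have sub2' : (L' *m u <= W')%MS by rewrite eW' sub_col_mxr.
have ort' : W' *m S *m W^T = 0 by apply: orth_sym.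
rewrite /cyclic_part (mul_col_mx _ _ u) !gram_col_mx LL LL'.
rewrite (orthogonalS sub1 sub1' ort) (orthogonalS sub1' sub1 ort').
rewrite (orthogonalS sub2 sub1' ort) (orthogonalS sub2' sub1 ort') block_mx0; split=> //.
  by rewrite tr_block_mx !trmx0 QT QT'.
by rewrite unitmxE det_lblock unitrM -!unitmxE uQ.
Qed.

Lemma reversible_add W W' : reversible_type W -> reversible_type W' ->
  orthogonal W W' -> reversible_type (W + W')%MS.
Proof.
move=> [p [q [V0 [V1 [[V01 a0 a1 b0 b1] eW]]]]] [p' [q' [V0' [V1' [[V01' a0' a1' b0' b1'] eW']]]]] ort.
exists (p + p')%N, (q + q')%N, (col_mx V0 V0'), (col_mx V1 V1'); split; last exact: addsmx_col4.
have sub0 : (V0 <= W)%MS by rewrite eW sub_col_mxl.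
have sub1 : (V1 <= W)%MS by rewrite eW sub_col_mxr.
have sub0' : (V0' <= W')%MS by rewrite eW' sub_col_mxl.
have sub1' : (V1' <= W')%MS by rewrite eW' sub_col_mxr.
have ort' : W' *m S *m W^T = 0 by apply: orth_sym.
split; last 4 first.
- by rewrite mul_col_mx col_mxS.
- by rewrite mul_col_mx col_mxS.
- by rewrite mul_col_mx col_mxS.
- by rewrite mul_col_mx col_mxS.
by rewrite gram_col_mx V01 V01' (orthogonalS sub0 sub1' ort) (orthogonalS sub0' sub1 ort') block_mx0.
Qed.

Lemma odd_type_reversible W : odd_type S u W -> reversible_type W.
Proof.
by move=> [m [e [L [L' [p [q [V0 [V1 [_ _ h _ eW]]]]]]]]]; exists p, q, V0, V1.
Qed.

Lemma reversible_type0 : reversible_type 0.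
Proof.
exists 0%N, 0%N, 0, 0; split; first by split; rewrite ?mul0mx ?sub0mx.
by apply/eqmxP; rewrite sub0mx col_mx_sub !sub0mx.
Qed.

Lemma cyclic_type0 : cyclic_type S u 0 0.
Proof.
exists 0; split; last by apply/eqmxP; rewrite sub0mx col_mx_sub mul0mx !sub0mx.
by split; rewrite ?mul0mx ?trmx0 // -row_free_unit /row_free mxrank0.
Qed.

(** One odd piece [WT] is kept apart to correct the parity of the cyclic part [WE]; of the other odd
    pieces only reversibility is remembered. *)
Definition decomposed U : Prop :=
  (exists m, cyclic_type S u m U) \/
  exists m WE WT WR, [/\ cyclic_type S u m WE, odd_type S u WT, reversible_type WR,
    [/\ orthogonal WE WT, orthogonal WE WR & orthogonal WT WR] &
    (WE *m u <= WE)%MS /\ (WE + WT + WR :=: U)%MS].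

Lemma orthogonal_addr W W1 W2 : orthogonal W W1 -> orthogonal W W2 -> orthogonal W (W1 + W2)%MS.
Proof.
move=> /gram_eq0P h1 /gram_eq0P h2; apply/gram_eq0P => x y xW /sub_addsmxP[[d1 d2] ->] /=.
by rewrite sformDr // h1 ?submxMl // h2 ?submxMl // addr0.
Qed.

Lemma orthogonal_sym W W' : orthogonal W W' -> orthogonal W' W.
Proof. exact: orth_sym. Qed.

Lemma cyclic_type_eqmx m W W' : (W :=: W')%MS -> cyclic_type S u m W -> cyclic_type S u m W'.
Proof.
by move=> e [L [h eW]]; exists L; split=> //; apply: eqmx_trans (eqmx_sym e) eW.
Qed.

Lemma decomposition U : (U *m u <= U)%MS -> regular S U -> decomposed U.
Proof.
elim: {U}(\rank U) {-2}U (leqnn (\rank U)) => [|k IH] U le stU regU.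
  left; exists 0%N; apply: cyclic_type_eqmx cyclic_type0.
  by move: le; rewrite leqn0 mxrank_eq0 => /eqP->.
have [U0 | U0] := eqVneq U 0.
  by left; exists 0%N; rewrite U0; exact: cyclic_type0.
have [W [W0 WU stW regW hW]] := exists_piece two_neq0 S_skew S_unit hu stU regU U0.
have [U' [stU' regU' ort sumU ltU]] := regular_split S_skew S_unit hu WU stW stU regW regU W0.
have le' : (\rank U' <= k)%N by rewrite -ltnS; apply: leq_trans ltU le.
have [[m' hU'] | [m' [WE [WT [WR [hE hT hR [oET oER oTR] [stE eU']]]]]]] := IH U' le' stU' regU'.
  case: hW => [[m hW] | hW].
    by left; exists (m + m')%N; apply: cyclic_type_eqmx sumU _; apply: cyclic_add.
  right; exists m', U', W, 0; split=> //; first exact: reversible_type0.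
    by split; rewrite /orthogonal ?trmx0 ?mulmx0 //; apply: orth_sym.
  split=> //; apply: eqmx_trans sumU; apply/eqmxP/andP; split.
    by rewrite !addsmx_sub addsmxSl addsmxSr sub0mx.
  rewrite addsmx_sub (submx_trans (addsmxSr _ _) (addsmxSl _ _)).
  by rewrite (submx_trans (addsmxSl _ _) (addsmxSl _ _)).
have sE : (WE <= U')%MS by rewrite -eU' (submx_trans (addsmxSl _ _) (addsmxSl _ _)).
have sT : (WT <= U')%MS by rewrite -eU' (submx_trans (addsmxSr _ _) (addsmxSl _ _)).
have sR : (WR <= U')%MS by rewrite -eU' addsmxSr.
have oWE : orthogonal W WE by apply: orthogonalS ort.
have oWT : orthogonal W WT by apply: orthogonalS ort.
have oWR : orthogonal W WR by apply: orthogonalS ort.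
case: hW => [[m hW] | hW].
  right; exists (m + m')%N, (W + WE)%MS, WT, WR; split=> //; first exact: cyclic_add.
    by split=> //; apply: orthogonal_sym; apply: orthogonal_addr; apply: orthogonal_sym.
  split; first by rewrite addsmxMr addsmxS.
  apply: eqmx_trans sumU; rewrite -!addsmxA; apply: adds_eqmx => //.
  by rewrite addsmxA.
(* The new odd piece is the one kept apart, and the previous one joins the reversible part. *)
right; exists m', WE, W, (WT + WR)%MS; split=> //.
- by apply: reversible_add => //; apply: odd_type_reversible.
- by split; [apply: orthogonal_sym | apply: orthogonal_addr | apply: orthogonal_addr].
- split=> //; apply: eqmx_trans sumU; rewrite [(WE + W)%MS]addsmxC -addsmxA; apply: adds_eqmx => //.
  by rewrite addsmxA.
Qed.

(** Scalars are self-adjoint for every symmetric form, so [cyclic_frame] applies whatever the value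
    of [x]. *)
Lemma cyclic_scalar m W x : cyclic_type S u m W ->
  exists L L' : 'M[F]_(m, n.+1), scalar_part S u x L L' /\ (W :=: col_mx L L')%MS.
Proof.
move=> [L [hL eW]]; have [LL QT _] := hL.
have hQ : (x%:M *m (L *m u *m S *m L^T))^T = x%:M *m (L *m u *m S *m L^T).
  by rewrite mul_scalar_mx linearZ /= QT.
have [L' [Q [uQ' L'L' LL' e]]] : exists (L' : 'M[F]_(m, n.+1)) (Q : 'M[F]_m),
    [/\ Q \in unitmx, L' *m S *m L'^T = 0, L *m S *m L'^T = 1%:M &
        L *m u = x *: L - Q *m L'].
  have [L'L' LL' e] := cyclic_frame S_skew hu hL hQ; rewrite mul_scalar_mx in L'L' LL' e.
  by have [_ _ uQ] := hL; eexists; exists (L *m u *m S *m L^T); split; [| exact: L'L' | |].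
exists L, L'; split; first by split=> //; exists (- Q); rewrite e mulNmx.
apply: eqmx_trans eW _; apply/eqmxP/andP; rewrite !col_mx_sub !sub_col_mxl /=; split.
  rewrite e; apply: addmx_sub; first by rewrite scalemx_sub ?sub_col_mxl.
  by rewrite eqmx_opp (submx_trans (submxMl _ _)) ?sub_col_mxr.
have -> : L' = invmx Q *m (x *: L - L *m u).
  by rewrite e opprB addrC subrK mulKmx.
apply: submx_trans (submxMl _ _) _.
by apply: addmx_sub; rewrite ?eqmx_opp ?scalemx_sub ?sub_col_mxl ?sub_col_mxr.
Qed.

Lemma scalar_add m m' x (L L' : 'M[F]_(m, n.+1)) (M M' : 'M[F]_(m', n.+1)) :
  scalar_part S u x L L' -> scalar_part S u x M M' ->
  col_mx L L' *m S *m (col_mx M M')^T = 0 ->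
  scalar_part S u x (col_mx L M) (col_mx L' M').
Proof.
move=> [LL L'L' LL' [D hD]] [MM M'M' MM' [E hE]] ort.
have ort' := orth_sym S_skew ort.
move: ort ort'; rewrite !gram_col_mx -!block_mx0 => /eq_block_mx[o1 o2 o3 o4] /eq_block_mx[o1' o2' o3' o4'].
split.
- by rewrite gram_col_mx LL MM o1 o1' !block_mx0.
- by rewrite gram_col_mx L'L' M'M' o4 o4' !block_mx0.
- by rewrite gram_col_mx LL' MM' o2 o2' -scalar_mx_block.
- exists (block_mx D 0 0 E).
  by rewrite mul_col_mx hD hE mul_block_col !mul0mx addr0 add0r scale_col_mx add_col_mx.
Qed.

Lemma even_scalar_reversible_prod4 k x (L L' : 'M[F]_(k, n.+1)) W : ~~ odd k -> x != 0 ->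
  scalar_part S u x L L' -> (col_mx L L' *m u <= col_mx L L')%MS -> reversible_type W ->
  col_mx L L' *m S *m W^T = 0 -> row_full (col_mx L L' + W)%MS -> mx_prod4 S u.
Proof.
move=> ev; have ek : k = (k./2 + k./2)%N by rewrite addnn even_halfK.
move: L L'; rewrite ek => L L' x0 hL stL [p [q [V0 [V1 [hV eW]]]]] ort full.
apply: (assembly_prod4 two_neq0 infF S_skew S_unit hu x0 hL stL hV).
  by apply: orthogonalS (submx_refl _) _ ort; rewrite eW.
by rewrite -sub1mx (submx_trans _ (addsmxS (submx_refl _) (_ : (W <= _)%MS))) ?sub1mx // eW.
Qed.

Lemma reversible_type_stable W : reversible_type W -> (W *m u <= W)%MS.
Proof.
move=> [p [q [V0 [V1 [[_ s0 s1 t0 t1] eW]]]]].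
rewrite (eqmxMr _ eW) eW mul_col_mx !(half_sum u two_neq0) col_mx_sub.
rewrite !scalemx_sub ?addmx_sub //.
- exact: submx_trans s1 (sub_col_mxr _ _).
- exact: submx_trans t1 (sub_col_mxl _ _).
- exact: submx_trans s0 (sub_col_mxl _ _).
- exact: submx_trans t0 (sub_col_mxr _ _).
Qed.

(** For even [m] the cyclic part is taken with the scalar 1 and [WT] counts as reversible. For odd
    [m] it is taken with the scalar [e] imposed by [WT], and the two Lagrangians together have even
    dimension. *)
Lemma mx_prod4_odd_case m WE WT WR : cyclic_type S u m WE -> odd_type S u WT ->
  reversible_type WR -> orthogonal WE WT -> orthogonal WE WR -> orthogonal WT WR ->
  (WE *m u <= WE)%MS -> (WE + WT + WR :=: 1%:M)%MS -> mx_prod4 S u.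
Proof.
move=> hE hT hR oET oER oTR stE full.
have rT := odd_type_reversible hT.
have [em | om] := boolP (odd m); last first.
  have [L [L' [hL eL]]] := cyclic_scalar 1 hE.
  apply: (even_scalar_reversible_prod4 om (oner_neq0 F) hL _ (reversible_add rT hR oTR)).
  - by rewrite -(eqmxMr _ eL) -eL.
  - by apply: orthogonalS (submx_refl _) (orthogonal_addr oET oER); rewrite -eL.
  - by rewrite -sub1mx -(adds_eqmx eL (eqmx_refl _)) addsmxA full.
have [mT [e [M [M' [p [q [V0 [V1 [[oddT e0] hM _ eM _]]]]]]]]] := hT.
have [L [L' [hL eL]]] := cyclic_scalar e hE.
have ort : col_mx L L' *m S *m (col_mx M M')^T = 0.
  by apply: orthogonalS oET; rewrite -?eL -?eM.
have hLM := scalar_add hL hM ort.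
have eLM := addsmx_col4 eL eM.
apply: (even_scalar_reversible_prod4 _ e0 hLM _ hR).
- by rewrite oddD em oddT.
- by rewrite -(eqmxMr _ eLM) -eLM addsmxMr addsmxS // reversible_type_stable.
- apply: (orthogonalS _ (submx_refl WR) (_ : (WE + WT)%MS *m S *m WR^T = 0)); first by rewrite -eLM.
  by apply/(orth_sym S_skew)/orthogonal_addr; apply: orth_sym.
- by rewrite -sub1mx -(adds_eqmx eLM (eqmx_refl _)) full.
Qed.

Lemma mx_prod4_or_cyclic : mx_prod4 S u \/ exists m, cyclic_type S u m 1%:M.
Proof.
have [|||] := @decomposition 1%:M.
- exact: submx1.
- move=> z _ h; apply: (can_inj (mulmxK S_unit)); rewrite mul0mx; apply/rowP => i.
  by have := h (delta_mx 0 i) (submx1 _); rewrite /sform trmx_delta -colE !mxE.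
- by right.
by move=> [m [WE [WT [WR [hE hT hR [oET oER oTR] [stE full]]]]]]; left; apply: (mx_prod4_odd_case hE hT hR).
Qed.

Lemma mx_prod4_cyclic m : ~~ odd m -> cyclic_type S u m 1%:M -> mx_prod4 S u.
Proof.
move=> om /(cyclic_scalar 1)[L [L' [hL eL]]].
apply: (even_scalar_reversible_prod4 om (oner_neq0 F) hL _ reversible_type0).
- by rewrite -eL submx1.
- by rewrite trmx0 mulmx0.
- by rewrite -sub1mx -(adds_eqmx eL (eqmx_refl _)) addsmxSl.
Qed.

Lemma cyclic_type_dim m : cyclic_type S u m 1%:M -> (m + m)%N = n.+1.
Proof.
move=> /(cyclic_scalar 1)[L [L' [[LL L'L' LL' _] eL]]].
have := mxrank_unit (std_form_unit F m); rewrite -(std_frame S_skew LL L'L' LL') => e.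
apply/eqP; rewrite eqn_leq; apply/andP; split.
  have := mxrankM_maxl (col_mx L L') (S *m (col_mx L L')^T).
  by rewrite mulmxA e => h; apply: leq_trans h (rank_leq_col _).
by rewrite -(mxrank1 F n.+1) eL rank_leq_row.
Qed.

(** A purely cyclic space has [m + m = n.+1], so here its [m] is even. *)
Lemma mx_prod4_of_dvd4 : (4 %| n.+1)%N -> mx_prod4 S u.
Proof.
move=> dv; case: mx_prod4_or_cyclic => [h|]; first exact: h.
move=> [m hm].
apply: (mx_prod4_cyclic _ hm); have := cyclic_type_dim hm; move/dvdnP: dv => [k ->]; lia.
Qed.

Lemma mx_prod5_of_gt2 : (2 < n.+1)%N -> mx_prod5 S u.
Proof.
move=> gt2; have prod45 : mx_prod4 S u -> mx_prod5 S u.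
  by move=> h; exists 1%:M, u; rewrite mul1mx; split=> //; apply: mx_invol1.
case: mx_prod4_or_cyclic => [h|]; first exact: prod45.
move=> [m hm].
have [om | om] := boolP (odd m); last by apply/prod45/(mx_prod4_cyclic om).
have dm := cyclic_type_dim hm; have [L [hL _]] := hm.
(* [m] is odd and [m + m > 2], so [m] is at least 3 and the predecessor of [m./2] is not
   truncated. *)
have em : m = (1 + ((m./2).-1.+1 + (m./2).-1.+1))%N by lia.
move: L hL dm; rewrite em => L hL dm.
exact: (odd_cyclic_prod5 two_neq0 infF S_skew hu dm hL).
Qed.

End OrthogonalSum.

(** * Passage from endomorphisms to matrices *)

Import passmx.

Section MatrixOfForm.
Variables (F : fieldType) (V : vectType F) (s : {biscalar V}).
Hypothesis s_sympl : symplectic_form s.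

Local Notation n := (\dim {:V}).
Let e := vbasis {:V}.
Let e_basis : basis_of {:V} e := vbasisP {:V}.
Let e_free : free e := basis_free e_basis.

Definition form_mx : 'M[F]_n := \matrix_(i, j) s e`_i e`_j.

Lemma form_mxE (x y : 'rV[F]_n) : s (vecof e x) (vecof e y) = (x *m form_mx *m y^T) 0 0.
Proof.
rewrite /vecof linear_sumr mxE; apply: eq_bigr => j _.
rewrite linearZr_LR linear_sumlz !mxE /= mulrC; congr (_ * _).
by apply: eq_bigr => i _; rewrite linearZl_LR mxE.
Qed.

Lemma form_mx_skew : form_mx^T = - form_mx.
Proof.
have [alt _] := s_sympl; apply/matrixP => i j; rewrite !mxE.
apply/eqP; rewrite -addr_eq0 addrC; apply/eqP.
have := alt (e`_i + e`_j); rewrite linearDl /= !linearDr /= !alt add0r addr0.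
done.
Qed.

Lemma form_mx_unit : form_mx \in unitmx.
Proof.
have [_ nondeg] := s_sympl; rewrite -row_free_unit -kermx_eq0.
apply/eqP/row_matrixP => i; rewrite row0; set c := row i _.
have hc : c *m form_mx = 0 by apply/sub_kermxP; apply: row_sub.
apply/eqP; rewrite -(vecof_eq0 e_basis); apply/eqP/nondeg => y.
by rewrite -(rVofK e_basis y) form_mxE hc mul0mx mxE.
Qed.

Lemma mxof_isom (u : 'End(V)) : Sp s u <-> mx_isom form_mx (mxof e e u).
Proof.
split=> [[_ hu] | hu].
  apply/matrixP => i j.
  have entry (A : 'M[F]_n) : (('e_i : 'rV[F]_n) *m A *m ('e_j : 'rV[F]_n)^T) 0 0 = A i j.
    by rewrite trmx_delta -rowE -colE !mxE.
  rewrite -[RHS]entry -form_mxE -hu !(hom_vecof e e_basis) form_mxE -[LHS]entry trmx_mul.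
  by rewrite !mulmxA.
split.
  have uu := mx_isom_unit form_mx_unit hu.
  have inv (A B : 'M[F]_n) x : A *m B = 1%:M -> hommx e e B (hommx e e A x) = x.
    move=> AB; rewrite -comp_lfunE -(hommx_mul e_basis e_basis e_basis) AB.
    by rewrite -(mxof1 e_free) (mxofK e_basis e_basis) id_lfunE.
  move: uu (mxofK e_basis e_basis u); move: (mxof e e u) => M uu <-.
  by exists (hommx e e (invmx M)) => x; rewrite inv ?mulmxV ?mulVmx.
move=> x y; rewrite -(rVofK e_basis x) -(rVofK e_basis y) !(hom_vecof e e_basis) !form_mxE.
by rewrite trmx_mul !mulmxA -2!(mulmxA (rVof e x)) hu.
Qed.

Lemma mxof_invol (i : 'End(V)) : Sp_involution s i <-> mx_invol form_mx (mxof e e i).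
Proof.
rewrite /Sp_involution /mx_invol mxof_isom -(mxof_comp e e e_basis) -(mxof1 e_free).
by split=> -[h e1]; split=> //; [rewrite e1 | apply: (can_inj (mxofK e_basis e_basis))].
Qed.

Lemma hommx_invol (i : 'M[F]_n) : mx_invol form_mx i -> Sp_involution s (hommx e e i).
Proof. by move=> hi; apply/mxof_invol; rewrite hommxK. Qed.

Lemma mx_prod4_Sp u : mx_prod4 form_mx (mxof e e u) -> prod_of_Sp_involutions s 4 u.
Proof.
move=> [M1 [M2 [/mx_reversible_invols[i1 [j1 [hi1 hj1 e1]]]
  /mx_reversible_invols[i2 [j2 [hi2 hj2 e2]]] eu]]].
(* The order is reversed because matrices act on row vectors from the right, while [comp_lfun]
   composes functions. *)
exists (fun k : 'I_4 => hommx e e (nth 0 [:: j2; i2; j1; i1] k)); split.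
  by case; do 4?case=> //; move=> *; apply: hommx_invol.
rewrite !big_ord_recl big_ord0 /= comp_lfun1r -!(hommx_mul e_basis e_basis e_basis).
by rewrite -[LHS](mxofK e_basis e_basis) eu e1 e2 !mulmxA.
Qed.

Lemma mx_prod5_Sp u : mx_prod5 form_mx (mxof e e u) -> prod_of_Sp_involutions s 5 u.
Proof.
move=> [k [v [hk [M1 [M2 [/mx_reversible_invols[i1 [j1 [hi1 hj1 e1]]]
  /mx_reversible_invols[i2 [j2 [hi2 hj2 e2]]] ev]]] eu]]].
exists (fun l : 'I_5 => hommx e e (nth 0 [:: j2; i2; j1; i1; k] l)); split.
  by case; do 5?case=> //; move=> *; apply: hommx_invol.
rewrite !big_ord_recl big_ord0 /= comp_lfun1r -!(hommx_mul e_basis e_basis e_basis).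
by rewrite -[LHS](mxofK e_basis e_basis) eu ev e1 e2 !mulmxA.
Qed.

Lemma exists_not_prod3 : 2%:R != 0 :> F -> (0 < n)%N ->
  exists u : 'End(V), Sp s u /\ ~ prod_of_Sp_involutions s 3 u.
Proof.
move=> two_neq0 n0; pose w : 'rV[F]_n := delta_mx 0 (Ordinal n0).
have w0 : w != 0.
  by apply/eqP => /rowP/(_ (Ordinal n0))/eqP; rewrite !mxE !eqxx oner_eq0.
pose t := transvection form_mx w; exists (hommx e e t); split.
  by apply/mxof_isom; rewrite hommxK //; exact: transvection_isom two_neq0 form_mx_skew w.
move=> [i [hi et]]; move: et; rewrite !big_ord_recl big_ord0 /= comp_lfun1r.
move/(congr1 (mxof e e)); rewrite hommxK // !(mxof_comp e e e_basis) -/t.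
apply: (transvection_not_prod3 two_neq0 form_mx_skew form_mx_unit w0); apply/mxof_invol; exact: hi.
Qed.

End MatrixOfForm.

Theorem theorem1p1 (F : fieldType) (F_infinite : infinite_set [set: F]%classic)
    (F_char : 2%N \notin [pchar F]) (V : vectType F) (n : nat)
    (dimV : \dim {:V} = n) (n_gt0 : (0 < n)%N)
    (s : {biscalar V}) (s_sympl : symplectic_form s) :
  ((4 %| n)%N ->
     (forall u : 'End(V), Sp s u -> prod_of_Sp_involutions s 4 u) /\
     (exists u : 'End(V), Sp s u /\ ~ prod_of_Sp_involutions s 3 u)) /\
  ((n = 2 %[mod 4])%N -> (2 < n)%N ->
     (forall u : 'End(V), Sp s u -> prod_of_Sp_involutions s 5 u) /\
     (exists u : 'End(V), Sp s u /\ ~ prod_of_Sp_involutions s 3 u)).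
Proof.
have two_neq0 : 2%:R != 0 :> F by move: F_char; rewrite inE.
have low := @exists_not_prod3 F V s s_sympl two_neq0.
rewrite dimV in low; have hlow := low n_gt0.
have S_skew := form_mx_skew s_sympl; have S_unit := form_mx_unit s_sympl.
split=> [dv | _ gt2]; split=> // u /(mxof_isom s_sympl) hu.
  apply: mx_prod4_Sp => //; move: S_skew S_unit hu.
  move: (form_mx s) (mxof _ _ u); rewrite dimV; case: n n_gt0 dv {dimV low} => // k _ dv S M hS uS hM.
  exact: (mx_prod4_of_dvd4 two_neq0 F_infinite hS uS hM dv).
apply: mx_prod5_Sp => //; move: S_skew S_unit hu.
move: (form_mx s) (mxof _ _ u); rewrite dimV; case: n n_gt0 gt2 {dimV low} => // k _ gt2 S M hS uS hM.
exact: (mx_prod5_of_gt2 two_neq0 F_infinite hS uS hM gt2).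
Qed.
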